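(* Let $N\ge 3$, $n\ge 2$, let $a_1,\dots,a_n\in\mathbb{R}^N$ be distinct poles, and let $r_0=\min_{i\ne j}|a_i-a_j|/2$, $i,j=1,\dots,n$. Let $\mu\ge 0$ be a weight function on $\mathbb{R}^N$ satisfying the following two hypotheses. $H_1)$ $\nabla\mu\in L^1_{loc}(\mathbb{R}^N)$, $\sqrt{\mu}\in H^1_{loc}(\mathbb{R}^N)$ and $\mu^{-1}\in L^1_{loc}(\mathbb{R}^N)$. $H_2')$ There exist constants $k_1,k_2\in\mathbb{R}$, $k_2>2-N$, such that if $$f_{\varepsilon,i}=(\varepsilon+|x-a_i|^2)^{\frac{\alpha}{2}},\qquad \alpha<0,\quad \varepsilon>0,$$ it holds $$\frac{\nabla f_{\varepsilon,i}}{f_{\varepsilon,i}}\cdot\nabla\mu=\frac{\alpha(x-a_i)}{\varepsilon+|x-a_i|^2}\cdot\nabla\mu\ \le\ \Bigl(k_1+\frac{k_2\alpha}{\varepsilon+|x-a_i|^2}\Bigr)\mu\qquad\text{in }B(a_i,r_0)$$ for any $i=1,\dots,n$ and for any $\varepsilon>0$. Then there exists a constant $k_0\in[0,\pi^2)$ such that $$c\int_{\mathbb{R}^N}\sum_{i=1}^n\frac{\varphi^2}{|x-a_i|^2}\,d\mu\ \le\ \int_{\mathbb{R}^N}|\nabla\varphi|^2\,d\mu+\left[\frac{k_0+(n+1)c}{r_0^2}+k_1\right]\int_{\mathbb{R}^N}\varphi^2\,d\mu$$ for all $\varphi\in H^1_\mu$, where $c\in(0,c_o(N+k_2)]$ with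 $c_o(N+k_2)=\left(\frac{N+k_2-2}{2}\right)^2$.
   Context: Here $d\mu(x)=\mu(x)\,dx$, $L^2_\mu:=L^2(\mathbb{R}^N,d\mu)$, and $B(a,r)$ is the open ball of center $a$ and radius $r$. The weighted Sobolev space $H^1_\mu$ is the completion of $C_c^\infty(\mathbb{R}^N)$ with respect to the norm $\|u\|_{H^1_\mu}^2:=\|u\|_{L^2_\mu}^2+\|\nabla u\|_{L^2_\mu}^2$. *)

(* Defs.v *)
From HB Require Import structures.
From mathcomp Require Import all_boot all_order all_algebra.
From mathcomp Require Import all_classical all_reals all_analysis.
From mathcomp Require Import ring.

Set Implicit Arguments.
Unset Strict Implicit.
Unset Printing Implicit Defensive.

Import Order.TTheory GRing.Theory Num.Theory.
Import numFieldNormedType.Exports.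

Local Open Scope classical_set_scope.
Local Open Scope ring_scope.

(* Vectors of R^N are row vectors 'rV[R]_N.  MathComp-Analysis has no
   sigma-algebra on them; as it does for tuples, we take the one generated by
   the coordinates, which is the Borel sigma-algebra. *)

Definition measure_rV_display : measure_display -> measure_display.
Proof. exact. Qed.

Section measurable_rV.
Context (R : realType) (N : nat).

Let coors : 'I_N -> 'rV[R]_N -> R := fun i x => x ord0 i.

Let rV_set0 : g_sigma_preimage coors set0.
Proof. exact: sigma_algebra0. Qed.

Let rV_setC A : g_sigma_preimage coors A -> g_sigma_preimage coors (~` A).
Proof. exact: sigma_algebraC. Qed.

Let rV_bigcup (F : (set 'rV[R]_N)^nat) :
  (forall i, g_sigma_preimage coors (F i)) ->
  g_sigma_preimage coors (\bigcup_i (F i)).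
Proof. exact: sigma_algebra_bigcup. Qed.

HB.instance Definition _ :=
  @isMeasurable.Build (measure_rV_display default_measure_display)
    'rV[R]_N (g_sigma_preimage coors) rV_set0 rV_setC rV_bigcup.

End measurable_rV.

Lemma measurable_coord (R : realType) N (i : 'I_N) :
  measurable_fun [set: 'rV[R]_N] (fun x => x ord0 i).
Proof.
move=> _ Y mY; rewrite setTI; apply: sub_sigma_algebra => /=.
rewrite -bigcup_seq/=; exists i => /=; first by rewrite mem_index_enum.
by exists Y => //; rewrite setTI.
Qed.

Lemma measurable_fun_rVP d (T : measurableType d) (R : realType) N
    (f : T -> 'rV[R]_N) :
  measurable_fun [set: T] f <->
  forall i, measurable_fun [set: T] (fun t => f t ord0 i).
Proof.
split=> [mf i|mf].
  exact: (measurableT_comp (measurable_coord i) mf).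
move=> _ A mA.
pose G := [set B : set 'rV[R]_N | measurable (setT `&` f @^-1` B)].
suff : measurable `<=` G by apply.
apply: smallest_sub.
  split=> [|B GB|F GF]; rewrite /G/= ?setTI.
  - by rewrite preimage_set0.
  - rewrite setTD preimage_setC; apply: measurableC.
    by move: GB; rewrite /G/= setTI.
  - rewrite preimage_bigcup; apply: bigcupT_measurable => k.
    by have := GF k; rewrite /G/= setTI.
move=> B; rewrite -bigcup_seq/= => -[i _ [C mC <-]].
rewrite /G/= !setTI -comp_preimage -[X in measurable X]setTI.
exact: mf.
Qed.

(* Lebesgue measure on R^N, by R^(N+1) = R * R^N. *)

Section lebesgue_rV_step.
Context (R : realType) (N : nat).

Definition consrV (p : R * 'rV[R]_N) : 'rV[R]_N.+1 :=
  row_mx (p.1%:M : 'M[R]_1) p.2.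

Lemma consrV0 p : consrV p ord0 ord0 = p.1.
Proof.
rewrite mxE; case: splitP => [j|j] //=.
by rewrite (ord1 j) mxE eqxx mulr1n.
Qed.

Lemma consrVS p j : consrV p ord0 (lift ord0 j) = p.2 ord0 j.
Proof.
rewrite mxE; case: splitP => [k|k] /=; first by rewrite (ord1 k).
by rewrite /bump/= !add1n => -[jk]; congr (p.2 _ _); exact/val_inj.
Qed.

Lemma measurable_consrV : measurable_fun setT consrV.
Proof.
apply/measurable_fun_rVP => i; case: (unliftP ord0 i) => [j|] ->.
  under eq_fun do rewrite consrVS.
  apply: (measurableT_comp (measurable_coord j)).
  exact: measurable_snd.
by under eq_fun do rewrite consrV0; exact: measurable_fst.
Qed.

Definition unconsrV (x : 'rV[R]_N.+1) : R * 'rV[R]_N :=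
  (x ord0 ord0, \row_j x ord0 (lift ord0 j)).

Lemma consrVK p : unconsrV (consrV p) = p.
Proof.
case: p => t x; rewrite /unconsrV consrV0; congr pair.
by apply/rowP => j; rewrite mxE consrVS.
Qed.

Lemma measurable_unconsrV : measurable_fun setT unconsrV.
Proof.
apply: measurable_fun_pair; first exact: measurable_coord.
apply/measurable_fun_rVP => i; under eq_fun do rewrite mxE.
exact: measurable_coord.
Qed.

Variable m : {sigma_finite_measure set 'rV[R]_N -> \bar R}.

Definition lebesgue_rV_succ :=
  pushforward (@lebesgue_measure R \x m)%E consrV.

Let lebesgue_rV_succ0 : lebesgue_rV_succ set0 = 0%E.
Proof. by rewrite /lebesgue_rV_succ /pushforward preimage_set0 measure0. Qed.

Let lebesgue_rV_succ_ge0 A : (0 <= lebesgue_rV_succ A)%E.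
Proof. by rewrite /lebesgue_rV_succ /pushforward measure_ge0. Qed.

Let lebesgue_rV_succ_sigma_additive : semi_sigma_additive lebesgue_rV_succ.
Proof.
move=> F mF tF mUF; rewrite /lebesgue_rV_succ /pushforward preimage_bigcup.
have mpre A : measurable A -> measurable (consrV @^-1` A).
  by move=> mA; rewrite -[X in measurable X]setTI; exact: measurable_consrV.
apply: measure_semi_sigma_additive => [n||].
- exact: mpre.
- apply/trivIsetP => /= i j _ _ ij; rewrite -preimage_setI.
  by move/trivIsetP : tF => /(_ _ _ _ _ ij) ->//; rewrite preimage_set0.
- by rewrite -preimage_bigcup; exact: mpre.
Qed.

HB.instance Definition _ := isMeasure.Build _ _ _ lebesgue_rV_succ
  lebesgue_rV_succ0 lebesgue_rV_succ_ge0 lebesgue_rV_succ_sigma_additive.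

Let lebesgue_rV_succ_sigma_finite : sigma_finite setT lebesgue_rV_succ.
Proof.
have /sigma_finiteP[F [TF ndF Foo]] := sigma_finiteT (@lebesgue_measure R).
have /sigma_finiteP[G [TG ndG Goo]] := sigma_finiteT m.
exists (fun k => unconsrV @^-1` (F k `*` G k)).
  rewrite -preimage_bigcup (_ : \bigcup_k _ = setT) ?preimage_setT//.
  apply/seteqP; split=> // -[x y] _.
  have [n _ Fnx] : (\bigcup_n F n) x by rewrite -TF.
  have [k _ Gky] : (\bigcup_n G n) y by rewrite -TG.
  exists (maxn n k) => //; split.
    by move: x Fnx; exact/subsetPset/ndF/leq_maxl.
  by move: y Gky; exact/subsetPset/ndG/leq_maxr.
move=> k; have [mF FFoo] := Foo k; have [mG GFoo] := Goo k; split.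
  rewrite -[X in measurable X]setTI; apply: measurable_unconsrV => //.
  exact: measurableX.
rewrite /lebesgue_rV_succ /pushforward -comp_preimage.
rewrite (_ : unconsrV \o consrV = id); last first.
  by apply/funext => p; exact: consrVK.
by rewrite preimage_id product_measure1E// lte_mul_pinfty// ge0_fin_numE.
Qed.

HB.instance Definition _ := Measure_isSigmaFinite.Build _ _ _ lebesgue_rV_succ
  lebesgue_rV_succ_sigma_finite.

End lebesgue_rV_step.

Fixpoint lebesgue_rV (R : realType) (N : nat) :
    {sigma_finite_measure set 'rV[R]_N -> \bar R} :=
  match N with
  | 0 => \d_(0 : 'rV[R]_0)
  | N'.+1 => lebesgue_rV_succ (lebesgue_rV R N')
  end.

Lemma lebesgue_rV_box (R : realType) (N : nat) (a b : 'rV[R]_N) :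
  (forall i, a ord0 i <= b ord0 i) ->
  lebesgue_rV R N [set x : 'rV_N | forall i, a ord0 i <= x ord0 i <= b ord0 i] =
  (\prod_(i < N) (b ord0 i - a ord0 i))%:E.
Proof.
elim: N a b => [|N IH] a b ab.
  rewrite /= big_ord0 diracE mem_set//= => i; by case: i.
pose a' := \row_(j < N) a ord0 (lift ord0 j).
pose b' := \row_(j < N) b ord0 (lift ord0 j).
rewrite -[LHS]/((@lebesgue_measure R \x lebesgue_rV R N)%E ((@consrV R N) @^-1` _)).
rewrite (_ : _ @^-1` _ = `[a ord0 ord0, b ord0 ord0] `*`
    [set x : 'rV_N | forall i, a' ord0 i <= x ord0 i <= b' ord0 i]); last first.
  apply/seteqP; split=> -[t x]/=.
    move=> h; split; first by have := h ord0; rewrite consrV0/= in_itv.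
    by move=> i; rewrite !mxE; have := h (lift ord0 i); rewrite consrVS.
  rewrite in_itv/= => -[ht hx] i; case: (unliftP ord0 i) => [j|] ->.
    by have := hx j; rewrite consrVS !mxE.
  by rewrite consrV0.
rewrite product_measure1E//; last first.
  rewrite (_ : mkset _ = \bigcap_(i in [set: 'I_N])
      ((fun x : 'rV[R]_N => x ord0 i) @^-1` `[a' ord0 i, b' ord0 i])).
    apply: fin_bigcap_measurable => // i _; rewrite -[X in measurable X]setTI.
    exact: measurable_coord.
  apply/seteqP; split=> x /= h i => [_|]; have := h i; rewrite /= in_itv//=.
  exact.
rewrite IH => [|i]; last by rewrite !mxE.
rewrite big_ord_recl EFinM; congr (_ * _)%E.
  rewrite [LHS](lebesgue_measure_itv `[a ord0 ord0, b ord0 ord0])/= lte_fin.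
  case: ltP => [//|ba]; have /le_anti -> : a ord0 ord0 <= b ord0 ord0 <= a ord0 ord0.
    by rewrite ab.
  by rewrite subrr.
by congr EFin; apply: eq_bigr => i _; rewrite !mxE.
Qed.

Section euclidean.
Context (R : realType) (N : nat).
Implicit Types (x y : 'rV[R]_N) (f : 'rV[R]_N -> R).

(* The library norm `|x| on 'rV[R]_N is the sup norm. *)

Definition dotr x y : R := \sum_(i < N) x ord0 i * y ord0 i.

Definition enorm x : R := Num.sqrt (dotr x x).

Definition eball (a : 'rV[R]_N) (r : R) : set 'rV[R]_N :=
  [set x | enorm (x - a) < r].

Definition partial (j : 'I_N) f : 'rV[R]_N -> R :=
  fun x => 'D_(delta_mx ord0 j) f x.

Definition grad f (x : 'rV[R]_N) : 'rV[R]_N := \row_j partial j f x.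

(* C^oo: partial derivatives of all orders exist and are continuous. *)
Definition smooth f : Prop := forall s : seq 'I_N,
  let g := foldr partial f s in
  continuous g /\ forall x j, derivable g x (delta_mx ord0 j).

(* C_c^oo(R^N) *)
Definition test_function f : Prop :=
  smooth f /\ compact (closure [set x | f x != 0]).

(* In [L1loc] the function may take infinite values. *)
Definition L1loc (f : 'rV[R]_N -> \bar R) : Prop :=
  forall K : set 'rV[R]_N, compact K -> (lebesgue_rV R N).-integrable K f.

Definition L2loc f : Prop :=
  measurable_fun [set: 'rV[R]_N] f /\ L1loc (fun x => (f x ^+ 2)%:E).

(* [Df] is the distributional gradient of [f], and is locally integrable. *)
Definition is_weak_grad f (Df : 'rV[R]_N -> 'rV[R]_N) : Prop :=
  [/\ L1loc (EFin \o f),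
      forall j, L1loc (fun x => (Df x ord0 j)%:E) &
      forall psi, test_function psi -> forall j,
        (\int[lebesgue_rV R N]_x (f x * partial j psi x)%:E =
         - \int[lebesgue_rV R N]_x (Df x ord0 j * psi x)%:E)%E].

Definition H1loc f : Prop :=
  L2loc f /\ exists2 Df, is_weak_grad f Df &
    forall j, L2loc (fun x => Df x ord0 j).

End euclidean.

Section weighted.
Context (R : realType) (N : nat) (mu : 'rV[R]_N -> R).
Implicit Types (f phi : 'rV[R]_N -> R) (Dphi : 'rV[R]_N -> 'rV[R]_N).

(* integral of f with respect to dmu(x) = mu(x) dx *)
Definition wint f : \bar R := (\int[lebesgue_rV R N]_x (f x * mu x)%:E)%E.

(* ||phi||_{H^1_mu}^2, with Dphi in the role of grad phi *)
Definition H1mu_norm_sq phi Dphi : \bar R :=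
  (wint (fun x => phi x ^+ 2)%R + wint (fun x => enorm (Dphi x) ^+ 2)%R)%E.

(* The completion of C_c^oo(R^N) for the H^1_mu norm is realized, through the
   isometry u |-> (u, grad u), as the closure of the range of that map in the
   Hilbert space L^2_mu * (L^2_mu)^N.  So an element is a pair (phi, Dphi),
   where Dphi is what "grad phi" denotes; functions stand for their classes
   modulo almost everywhere equality. *)
Definition H1mu phi Dphi : Prop :=
  [/\ measurable_fun setT phi, measurable_fun setT Dphi,
      (H1mu_norm_sq phi Dphi < +oo)%E &
      exists2 u : nat -> 'rV[R]_N -> R, (forall k, test_function (u k)) &
        H1mu_norm_sq (fun x => u k x - phi x) (fun x => grad (u k) x - Dphi x)
          @[k --> \oo] --> 0%E].

(* The inverse is taken in the extended reals, so that 1 / 0 = +oo. *)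
Definition hyp_H1 (Dmu : 'rV[R]_N -> 'rV[R]_N) : Prop :=
  [/\ is_weak_grad mu Dmu,
      H1loc (fun x => Num.sqrt (mu x)) &
      L1loc (fun x => ((mu x)%:E^-1)%E)].

End weighted.

Definition f_eps (R : realType) (N : nat) (a : 'rV[R]_N) (alpha eps : R)
  (x : 'rV[R]_N) : R := (eps + enorm (x - a) ^+ 2) `^ (alpha / 2).

Definition hyp_H2 (R : realType) (N n : nat) (a : 'I_n -> 'rV[R]_N) (r0 : R)
    (mu : 'rV[R]_N -> R) (Dmu : 'rV[R]_N -> 'rV[R]_N) (k1 k2 : R) : Prop :=
  forall (i : 'I_n) (alpha eps : R), alpha < 0 -> 0 < eps ->
  {ae lebesgue_rV R N, forall x, eball (a i) r0 x ->
    dotr ((f_eps (a i) alpha eps x)^-1 *: grad (f_eps (a i) alpha eps) x)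
         (Dmu x)
    <= (k1 + k2 * alpha / (eps + enorm (x - a i) ^+ 2)) * mu x}.

Section gradient_f_eps.
Context (R : realType) (N : nat) (a : 'rV[R]_N) (alpha eps : R).
Hypothesis eps0 : 0 < eps.

Lemma dotr_ge0 (x : 'rV[R]_N) : 0 <= dotr x x.
Proof. by apply: sumr_ge0 => i _; rewrite -expr2 sqr_ge0. Qed.

Lemma enorm2 (x : 'rV[R]_N) : enorm x ^+ 2 = dotr x x.
Proof. by rewrite sqr_sqrtr// dotr_ge0. Qed.

Lemma grad_f_epsE (x : 'rV[R]_N) :
  (f_eps a alpha eps x)^-1 *: grad (f_eps a alpha eps) x =
  (alpha / (eps + enorm (x - a) ^+ 2)) *: (x - a).
Proof.
set e := eps + _; have e0 : 0 < e by rewrite ltr_wpDr// sqr_ge0.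
apply/rowP => j; rewrite !mxE.
pose d : R := x ord0 j - a ord0 j.
have lineE (h : R) : f_eps a alpha eps (h *: delta_mx ord0 j + x) =
    (e + 2 * h * d + h ^+ 2) `^ (alpha / 2).
  rewrite /f_eps /e !enorm2 -!addrA; congr ((_ + _) `^ _).
  rewrite /dotr (bigD1 j)//= [in RHS](bigD1 j)//=.
  under eq_bigr => i ij do rewrite !mxE eqxx/= (negPf ij) mulr0 add0r.
  rewrite /d !mxE !eqxx/= mulr1.
  under [in RHS]eq_bigr => i ij do rewrite !mxE.
  ring.
pose q (h : R) := e + 2 * h * d + h ^+ 2.
have q0 : q 0 = e by rewrite /q mulr0 mul0r expr0n /= !addr0.
have dq : is_derive (0 : R) (1 : R) q (2 * d).
  rewrite /q; apply: is_derive_eq.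
  by rewrite /= !scaler0 /GRing.scale/=; ring.
have dp : is_derive (q 0) (1 : R) (fun t : R => t `^ (alpha / 2))
    (alpha / 2 * e `^ (alpha / 2 - 1)).
  by rewrite q0; exact: is_derive1_powR.
have dc := is_derive1_comp dp dq.
have -> : partial j (f_eps a alpha eps) x =
    'D_1 ((fun t : R => t `^ (alpha / 2)) \o q) 0.
  suff E : (fun h : R => h^-1 *: ((f_eps a alpha eps \o shift x)
                                   (h *: delta_mx ord0 j) - f_eps a alpha eps x)) =
    (fun h : R => h^-1 *: ((((fun t : R => t `^ (alpha / 2)) \o q) \o shift 0)
                            (h *: (1 : R)) - ((fun t : R => t `^ (alpha / 2)) \o q) 0)).
    by rewrite /partial /derive E.
  by apply/funext => h /=; rewrite lineE q0 addr0 /q /GRing.scale/= mulr1.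
rewrite [X in _ * X]derive_val /f_eps -/e -/d.
have -> : e `^ (alpha / 2 - 1) = e `^ (alpha / 2) / e.
  rewrite powRB; first by rewrite powRr1// ltW.
  by apply/implyP => _; rewrite gt_eqF.
have p0 : e `^ (alpha / 2) != 0 by rewrite gt_eqF// powR_gt0.
rewrite /GRing.scale/= -/d; field.
by rewrite p0 gt_eqF.
Qed.

End gradient_f_eps.

Definition is_minimum (R : realType) (A : set R) (r : R) : Prop :=
  A r /\ lbound A r.

Definition c_o (R : realType) (t : R) : R := ((t - 2) / 2) ^+ 2.

(* Main.v *)
Require Import Defs.
From HB Require Import structures.
From mathcomp Require Import all_boot all_order all_algebra.
From mathcomp Require Import all_classical all_reals all_analysis.
From mathcomp Require Import measurable_realfun.
From mathcomp Require Import ring lra.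

Set Implicit Arguments.
Unset Strict Implicit.
Unset Printing Implicit Defensive.

Import Order.TTheory GRing.Theory Num.Theory.
Import numFieldNormedType.Exports.

Local Open Scope classical_set_scope.
Local Open Scope ring_scope.

(** Letting [alpha -> -oo] in (H2') gives [(x - a_i) . grad mu >= k2 mu] a.e. on
    the ball [B(a_i, r0)], and letting [alpha -> 0] gives [k1 >= 0].  Write
    [m = N + k2 - 2], [c = b (m - b)] with [0 <= b <= m / 2], and test the weak
    gradient of [mu] against [b u^2 P_i (x - a_i)], summed over [i], where
    [P_i = max (1 / (eps + |x - a_i|^2) - 1 / r0^2) 0] vanishes off the i-th
    ball.  At any point at most one [P_i] is positive, and there completing the
    square [|grad u + b P_i u (x - a_i)|^2 >= 0] gives the inequality with
    [k0 = 1] and [eps + |x - a_i|^2] in place of [|x - a_i|^2], for every test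
    function [u].  Since test functions must be smooth, [max y 0] is replaced by
    [soft eta y], which costs an error [eta] times a fixed integrable function.
    The inequality passes to [H^1_mu] for fixed [eps], and [eps -> 0] is Fatou's
    lemma. *)

(** * Directional derivatives of compositions and inverses *)

Lemma is_derive_comp (R : realType) (V : normedModType R) (h : R -> R)
    (f : V -> R) (x v : V) (a b : R) :
  is_derive (f x) 1 h a -> is_derive x v f b -> is_derive x v (h \o f) (a * b).
Proof.
(* Along the line [t *: v + x] a directional derivative is the derivative at [0] of a function of
   one real variable, to which the usual chain rule applies; the difference quotients are the same
   functions of [t]. *)
move=> dh [df fb]; pose g t := f (t *: v + x).
have g0 : g 0 = f x by rewrite /g scale0r add0r.
have dg : is_derive (0 : R) (1 : R) g b.
  apply: DeriveDef; first exact: (derivable1P f x v).1 df.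
  suff E : (fun t : R => t^-1 *: ((g \o shift 0) (t *: (1 : R)) - g 0)) =
      (fun t => t^-1 *: ((f \o shift x) (t *: v) - f x)).
    by rewrite -fb /derive E.
  by apply/funext => t /=; rewrite addr0 g0 /g [_%:A]mulr1.
have [dhg hgE] : is_derive (0 : R) (1 : R) (h \o g) (a * b).
  by apply: is_derive1_comp; rewrite g0.
apply: DeriveDef; first exact: (derivable1P (h \o f) x v).2.
suff E : (fun t : R => t^-1 *: (((h \o g) \o shift 0) (t *: (1 : R)) - (h \o g) 0))
    = (fun t => t^-1 *: (((h \o f) \o shift x) (t *: v) - (h \o f) x)).
  by rewrite -hgE /derive E.
by apply/funext => t /=; rewrite addr0 g0 /g [_%:A]mulr1.
Qed.

Lemma is_derive_inv (R : realType) (V : normedModType R) (f : V -> R)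
    (x v : V) (b : R) : f x != 0 -> is_derive x v f b ->
  is_derive x v (fun y => (f y)^-1) (- (f x) ^- 2 * b).
Proof.
by move=> f0 [df <-]; apply: DeriveDef; [exact: derivableV|rewrite deriveV].
Qed.

(** * A calculus that produces smooth functions *)

Section smooth_calculus.
Context (R : realType) (N : nat).
Local Notation V := 'rV[R]_N.
Implicit Types (f g u : V -> R) (x : V).

Lemma is_derive_coord x (v : V) j :
  is_derive x v (fun y : V => y ord0 j) (v ord0 j).
Proof.
have h (t : R) : t != 0 ->
    t^-1 *: (((fun y : V => y ord0 j) \o shift x) (t *: v) - x ord0 j)
    = v ord0 j.
  by move=> t0; rewrite /= !mxE addrK /GRing.scale/= mulKf.
have cv : t^-1 *: (((fun y : V => y ord0 j) \o shift x) (t *: v) - x ord0 j)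
    @[t --> 0^'] --> v ord0 j.
  apply: cvg_near_cst; near=> t; apply: h.
  by near: t; exact: nbhs_dnbhs_neq.
apply: DeriveDef; first by apply/cvg_ex; exists (v ord0 j).
by apply/cvg_lim => //; exact: Rhausdorff.
Unshelve. all: by end_near. Qed.

(* A class of smooth functions which, unlike [smooth] itself, is visibly
   closed under the algebraic operations and under [partial]. *)
Inductive elementary (u : V -> R) : (V -> R) -> Prop :=
| elem_base (s : seq 'I_N) : elementary u (foldr (@partial R N) u s)
| elem_cst r : elementary u (fun=> r)
| elem_coord j : elementary u (fun x => x ord0 j)
| elem_add f g of elementary u f & elementary u g :
    elementary u (fun x => f x + g x)
| elem_mul f g of elementary u f & elementary u g :
    elementary u (fun x => f x * g x)
| elem_inv f of (forall x, f x != 0) & elementary u f :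
    elementary u (fun x => (f x)^-1)
| elem_sqrt f of (forall x, 0 < f x) & elementary u f :
    elementary u (fun x => Num.sqrt (f x)).

Lemma partialE f df j : (forall x, is_derive x (delta_mx ord0 j) f (df x)) ->
  partial j f = df.
Proof. by move=> h; apply/funext => x; rewrite /partial derive_val. Qed.

(** By induction on the constructors: in each case the partial derivative is exhibited as a member
    of the class again, so the statement can be iterated. The sign conditions in [elem_inv] and
    [elem_sqrt] keep inverses and roots differentiable everywhere. *)
Lemma elementary_step u f : smooth u -> elementary u f ->
  continuous f /\
  forall j, (forall x, derivable f x (delta_mx ord0 j)) /\
            elementary u (partial j f).
Proof.
move=> su; elim=> [s|r|j|{}f g _ [cf df] _ [cg dg]|{}f g ef [cf df] eg [cg dg]
  |{}f f0 ef [cf df]|{}f f0 ef [cf df]].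
- split; first exact: (su s).1.
  move=> j; split=> [x|]; first exact: (su s).2.
  exact: (elem_base u (j :: s)).
- split; first exact: cst_continuous.
  move=> j; split=> [x|]; first exact: derivable_cst.
  rewrite (@partialE _ (fun=> 0)); exact: elem_cst.
- split; first by move=> x; exact: coord_continuous.
  move=> i; split=> [x|]; first by have [] := is_derive_coord x (delta_mx 0 i) j.
  rewrite (partialE (fun x => is_derive_coord x (delta_mx ord0 i) j)).
  exact: elem_cst.
- split; first by move=> x; exact: (continuousD (cf x) (cg x)).
  move=> j; have [{}df ef] := df j; have [{}dg eg] := dg j.
  have dfg x : is_derive x (delta_mx ord0 j) (fun x => f x + g x)
      (partial j f x + partial j g x).
    by apply: is_deriveD; exact: derivableP.
  split; first by move=> x; have [] := dfg x.
  by rewrite (partialE dfg); exact: elem_add.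
- split; first by move=> x; exact: (continuousM (cf x) (cg x)).
  move=> j; have [{}df ef'] := df j; have [{}dg eg'] := dg j.
  have dfg x : is_derive x (delta_mx ord0 j) (fun x => f x * g x)
      (f x * partial j g x + g x * partial j f x).
    by apply: is_deriveM; exact: derivableP.
  split; first by move=> x; have [] := dfg x.
  by rewrite (partialE dfg); apply: elem_add; apply: elem_mul.
- split; first by move=> x; exact: (continuousV (f0 x) (cf x)).
  move=> j; have [{}df ef'] := df j.
  (* The derivative is spelled with constants, products and inverses only, which are constructors of
     [elementary]. *)
  have dfV x : is_derive x (delta_mx ord0 j) (fun x => (f x)^-1)
      (-1 * ((f x)^-1 * (f x)^-1) * partial j f x).
    rewrite mulN1r -invfM -expr2.
    by apply: is_derive_inv (f0 x) _; exact: derivableP.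
  split; first by move=> x; have [] := dfV x.
  rewrite (partialE dfV); apply: elem_mul => //.
  apply: elem_mul; first exact: elem_cst.
  by apply: elem_mul; exact: elem_inv.
- split.
    by move=> x; exact: (continuous_comp (cf x) (@sqrt_continuous R (f x))).
  move=> j; have [{}df ef'] := df j.
  have dfs x : is_derive x (delta_mx ord0 j) (fun x => Num.sqrt (f x))
      ((2 * Num.sqrt (f x))^-1 * partial j f x).
    apply: (@is_derive_comp R _ Num.sqrt f); last exact: derivableP.
    exact: is_derive1_sqrt.
  split; first by move=> x; have [] := dfs x.
  rewrite (partialE dfs); apply: elem_mul => //; apply: elem_inv.
    by move=> x; rewrite mulf_neq0// gt_eqF// sqrtr_gt0.
  by apply: elem_mul; [exact: elem_cst|exact: elem_sqrt].
Qed.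

Lemma elementary_smooth u f : smooth u -> elementary u f -> smooth f.
Proof.
move=> su ef s /=; have {}ef : elementary u (foldr (@partial R N) f s).
  by elim: s => //= j s IH; have [_ /(_ j)[]] := elementary_step su IH.
have [c d] := elementary_step su ef; split=> // x j.
by have [] := d j.
Qed.

End smooth_calculus.

(** * Open sets and continuous functions are Borel for the coordinate sigma-algebra *)

Section borel_rV.
Context (R : realType) (N : nat).
Local Notation V := 'rV[R]_N.

(** Cubes with rational centre and half side [1 / (k + 1)] are countably many, and measurable
    coordinate by coordinate; an open set is the union of those it contains. *)
Lemma open_measurable_rV (U : set V) : open U -> measurable U.
Proof.
move=> oU.
pose B (p : 'rV[rat]_N * nat) : set V :=
  [set x | forall j, `|x ord0 j - ratr (p.1 ord0 j)| < p.2.+1%:R^-1].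
have mB p : measurable (B p).
  rewrite (_ : B p = \bigcap_(j in [set: 'I_N]) ((fun x : V => x ord0 j) @^-1`
      ball (ratr (p.1 ord0 j) : R) p.2.+1%:R^-1)).
    apply: fin_bigcap_measurable => // j _; rewrite -[X in measurable X]setTI.
    by apply: measurable_coord => //; exact: measurable_ball.
  by apply/seteqP; split=> x /= h j; [move=> _|]; have := h j;
    rewrite /ball/= distrC //; apply.
pose F p := if `[< B p `<=` U >] then B p else set0.
suff -> : U = \bigcup_p F p.
  apply: countable_bigcupT_measurable => // p; rewrite /F.
  by case: ifP => // _; exact: mB.
apply/seteqP; split=> x; last first.
  by move=> [p _]; rewrite /F; case: asboolP => // h /h.
move=> Ux; have /nbhs_ballP[e /= e0 xeU] : nbhs x U by exact: open_nbhs_nbhs.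
(* Half of [e], because a point of the cube is compared with [x] through the rational centre. *)
have [k ke] : exists k, 0 + k.+1%:R^-1 < e / 2.
  by apply: ltr_add_invr; rewrite divr_gt0.
rewrite add0r in ke.
have k0 : 0 < k.+1%:R^-1 :> R by rewrite invr_gt0.
have qP j : exists q : rat, `|x ord0 j - ratr q| < k.+1%:R^-1.
  have [|q] := @rat_in_itvoo R (x ord0 j) (x ord0 j + k.+1%:R^-1).
    by rewrite ltrDl.
  rewrite in_itv/= => /andP[q1 q2]; exists q.
  by rewrite distrC ger0_norm ?subr_ge0 ?ltW// ltrBlDl.
have [q {}qP] := choice qP.
exists (\row_j q j, k) => //; rewrite /F asboolT.
  by move=> j /=; rewrite mxE.
move=> y By; apply: xeU; split=> // i j; rewrite ord1 /ball/=.
have := By j; have := qP j; rewrite /= mxE; set r := ratr _ => h1 h2.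
rewrite -(subrK r (x ord0 j)) -addrA (splitr e).
apply: le_lt_trans (ler_normD _ _) _; apply: ltrD; first exact: lt_trans ke.
by apply: lt_trans ke; rewrite distrC.
Qed.

Lemma continuous_measurable_rV (f : V -> R) :
  continuous f -> measurable_fun setT f.
Proof.
move=> /continuousP cf; apply: (measurability _ (RGenOpens.measurableE R)).
move=> _ [_ [a [b ->] <-]]; rewrite setTI; apply: open_measurable_rV.
exact/cf/interval_open.
Qed.

End borel_rV.

(** The integrand agrees almost everywhere with its maximum with [0], which is nonnegative
    everywhere. *)
Lemma Rintegral_ae_ge0 d (T : measurableType d) (R : realType)
    (m : {measure set T -> \bar R}) (f : T -> R) :
  measurable_fun setT f -> {ae m, forall x, 0 <= f x} ->
  0 <= \int[m]_x f x.
Proof.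
move=> mf f0.
suff -> : \int[m]_x f x = \int[m]_x Num.max (f x) 0.
  by apply: Rintegral_ge0 => x _; rewrite le_max lexx orbT.
rewrite /Rintegral; congr fine; apply: ae_eq_integral => //.
- exact/measurable_EFinP.
- by apply/measurable_EFinP; apply: measurable_maxr.
- by apply: filterS f0 => x fx _; congr EFin; apply/esym/max_idPl.
Qed.

(** * Compact supports and integration by parts against a weak gradient *)

Section compact_support.
Context (R : realType) (N : nat).
Local Notation V := 'rV[R]_N.
Local Notation leb := (lebesgue_rV R N).
Implicit Types (f g u : V -> R).

Definition cpt_supp g := compact (closure [set x | g x != 0]).

Lemma cpt_supp_sub u g : (forall x, u x = 0 -> g x = 0) ->
  cpt_supp u -> cpt_supp g.
Proof.
move=> ug cu; apply: subclosed_compact cu _; first exact: closed_closure.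
by apply: closureS => x /=; apply: contra_neq => /ug.
Qed.

(** Off the closed support, [u] vanishes in a neighbourhood, so its derivative there is that of a
    constant. *)
Lemma cpt_supp_partial u j : cpt_supp u -> cpt_supp (partial j u).
Proof.
move=> cu; apply: subclosed_compact cu _; first exact: closed_closure.
rewrite [X in _ `<=` X]((closure_id _).1 (@closed_closure _ _)).
apply: closureS => x /= ux; apply: contrapT => xu.
have nx : nbhs x (~` closure [set x | u x != 0]).
  by apply: open_nbhs_nbhs; split=> //; apply/closed_openC/closed_closure.
case/negP: ux; apply/eqP; rewrite /partial -(derive_cst (0 : R) x (delta_mx ord0 j)).
apply: near_eq_derive; apply: filterS nx => y yu.
by apply: contrapT => uy; apply: yu; apply: subset_closure; apply/eqP.
Qed.

Lemma test_function_partial u j : test_function u -> test_function (partial j u).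
Proof.
move=> [su cu]; split; last exact: cpt_supp_partial.
by move=> s; have := su (rcons s j); rewrite foldr_rcons.
Qed.

Lemma compact_measurable_rV (K : set V) : compact K -> measurable K.
Proof.
move=> cK; rewrite -(setCK K); apply: measurableC; apply: open_measurable_rV.
by apply/closed_openC; apply: compact_closed cK.
Qed.

(** Local integrability gives measurability on each compact cube [K k], and these cubes exhaust the
    space. *)
Lemma L1loc_measurable (f : V -> \bar R) : L1loc f -> measurable_fun setT f.
Proof.
move=> lf.
pose K (k : nat) : set V :=
  [set x | forall j, `[(- k%:R : R), k%:R]%classic (x ord0 j)].
have cK k : compact (K k).
  apply: (@rV_compact R N (fun=> `[(- k%:R : R), k%:R]%classic)).
  by move=> _; exact: segment_compact.
have -> : setT = \bigcup_k K k.
  apply/seteqP; split=> // x _.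
  exists (\max_j Num.truncn `|x ord0 j|).+1 => // j /=.
  rewrite in_itv/= -ler_norml.
  apply: le_trans (ltW (truncnS_gt _)) _; rewrite ler_nat ltnS.
  exact: (leq_bigmax j).
apply/measurable_fun_bigcup => k; first exact: compact_measurable_rV.
by have /integrableP[] := lf _ (cK k).
Qed.

(** The product vanishes off the closed support of [g]; on this compact set [f] is integrable and
    [g], being continuous, is bounded. *)
Lemma L1loc_integrableM f g : L1loc (EFin \o f) -> continuous g -> cpt_supp g ->
  leb.-integrable setT (EFin \o (fun x => f x * g x)).
Proof.
move=> lf cg kg; set K := closure [set x | g x != 0] in kg.
have mK : measurable K by exact: compact_measurable_rV.
suff : leb.-integrable K (EFin \o (fun x => f x * g x)).
  move=> /(integrable_mkcond _ mK); apply: eq_integrable => //.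
  move=> x _; rewrite patchE; case: ifPn => // /negP xK; congr EFin.
  have [->|gx] := eqVneq (g x) 0; first by rewrite mulr0.
  by exfalso; apply: xK; rewrite inE; exact: subset_closure.
suff : leb.-integrable K ((EFin \o f) \* (EFin \o g))%E by exact: eq_integrable.
apply: integrableMl => //; first exact: lf.
  by apply: measurable_funTS; exact: continuous_measurable_rV.
have : compact (g @` K) by apply: continuous_compact => //; exact: continuous_subspaceT.
move=> /compact_bounded[M [rM gM]]; exists M; split=> // m Mm x Kx.
by apply: gM Mm _ _; exists x.
Qed.

(** [S] is the distributional divergence of the field [f * Psi]. In each component the definition of
    the weak gradient makes the two integrals opposite, and both are finite because [Psi j] has
    compact support. *)
Lemma weak_divergence f Df (Psi : 'I_N -> V -> R) : is_weak_grad f Df ->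
  (forall j, test_function (Psi j)) ->
  let S x := \sum_(j < N) (f x * partial j (Psi j) x + Df x ord0 j * Psi j x) in
  leb.-integrable setT (EFin \o S) /\ \int[leb]_x S x = 0.
Proof.
move=> [lf lDf wf] tPsi S.
pose h1 j x := f x * partial j (Psi j) x.
pose h2 j x := Df x ord0 j * Psi j x.
have i1 j : leb.-integrable setT (EFin \o h1 j).
  have [sd cd] := test_function_partial j (tPsi j).
  by apply: L1loc_integrableM => //; exact: (sd [::]).1.
have i2 j : leb.-integrable setT (EFin \o h2 j).
  have [sd cd] := tPsi j.
  by apply: L1loc_integrableM => //; [exact: lDf|exact: (sd [::]).1].
have i12 j : leb.-integrable setT ((EFin \o h1 j) \+ (EFin \o h2 j))%E.
  exact: integrableD.
have SE : EFin \o S =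
    (fun x => \sum_(j < N) ((EFin \o h1 j) \+ (EFin \o h2 j))%E x)%E.
  by apply/funext => x /=; rewrite -sumEFin.
split; first by rewrite SE; exact: integrable_sum.
rewrite /Rintegral.
have -> : (\int[leb]_x (S x)%:E = 0)%E; last by [].
rewrite -[X in integral _ _ X]/(EFin \o S) SE integral_sum// big1// => j _.
have wj : (\int[leb]_x (EFin \o h1 j) x = - \int[leb]_x (EFin \o h2 j) x)%E.
  exact: wf.
rewrite integralD// wj.
by rewrite addeC subee//; exact: integrable_fin_num (i2 j).
Qed.

End compact_support.

(** * The smoothed positive part and bounds on its derivative *)

Section soft_positive_part.
Context (R : realType).
Implicit Types (eta y : R).

(* A smooth approximation of [max y 0], within O(eta) of it; shifting by
   [eta] makes the derivative small on the whole half line [y <= 0]. *)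
Definition soft eta y : R :=
  (y - eta + Num.sqrt ((y - eta) * (y - eta) + eta ^+ 4)) / 2.

Definition dsoft eta y : R :=
  (1 + (y - eta) / Num.sqrt ((y - eta) * (y - eta) + eta ^+ 4)) / 2.

Let rad_gt0 eta y : 0 < eta -> 0 < (y - eta) * (y - eta) + eta ^+ 4.
Proof. by move=> e0; rewrite ltr_wpDl ?exprn_gt0// -expr2 sqr_ge0. Qed.

Let q eta y := Num.sqrt ((y - eta) * (y - eta) + eta ^+ 4).

Let q2 eta y : 0 < eta -> q eta y * q eta y = (y - eta) * (y - eta) + eta ^+ 4.
Proof. by move=> e0; rewrite -expr2 sqr_sqrtr// ltW// rad_gt0. Qed.

Let q_gt0 eta y : 0 < eta -> 0 < q eta y.
Proof. by move=> e0; rewrite sqrtr_gt0 rad_gt0. Qed.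

Let q_norm eta y : 0 < eta -> `|y - eta| <= q eta y.
Proof.
move=> e0; rewrite -sqrtr_sqr ler_wsqrtr// expr2 lerDl exprn_ge0//.
exact: ltW.
Qed.

(** Since [eta ^+ 4] is the square of [eta ^+ 2], the root exceeds [|y - eta|] by at most
    [eta ^+ 2], hence by at most [eta] when [eta <= 1]. *)
Let q_le eta y : 0 < eta -> q eta y <= `|y - eta| + eta ^+ 2.
Proof.
move=> e0.
have h : 0 <= `|y - eta| + eta ^+ 2 by rewrite addr_ge0// sqr_ge0.
rewrite -(ler_pXn2r (n := 2))// ?nnegrE//; last exact/ltW/q_gt0.
rewrite [leLHS]expr2 q2// -expr2 -[(y - eta) ^+ 2]real_normK ?num_real//.
set n := `|_|; rewrite -subr_ge0.
have -> : (n + eta ^+ 2) ^+ 2 - (n ^+ 2 + eta ^+ 4) = 2 * n * eta ^+ 2 by ring.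
by rewrite mulr_ge0 ?sqr_ge0 ?mulr_ge0 ?normr_ge0.
Qed.

Lemma is_derive_soft eta y : 0 < eta -> is_derive y 1 (soft eta) (dsoft eta y).
Proof.
move=> e0; pose z := fun y : R => y - eta.
have dz : is_derive y (1 : R) z 1.
  by apply: is_derive_eq; rewrite /= subr0.
have dr : is_derive y (1 : R) (fun y => z y * z y + eta ^+ 4) (z y + z y).
  apply: is_derive_eq; rewrite /GRing.scale/=; ring.
have ds := @is_derive_comp R _ Num.sqrt (fun y => z y * z y + eta ^+ 4)
  y 1 _ _ (is_derive1_sqrt (rad_gt0 y e0)) dr.
have -> : soft eta = (fun y => 2^-1 * (z y + (Num.sqrt \o
    (fun y => z y * z y + eta ^+ 4)) y)).
  by apply/funext => w; rewrite mulrC.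
apply: is_derive_eq; rewrite /GRing.scale/= /dsoft.
have := q_gt0 y e0; rewrite /q /z; set r := Num.sqrt _ => r0.
by field; rewrite gt_eqF.
Qed.

Lemma soft_ge0 eta y : 0 < eta -> 0 <= soft eta y.
Proof.
move=> e0; rewrite divr_ge0// -lerBlDl sub0r.
by apply: le_trans (q_norm y e0); rewrite -normrN ler_norm.
Qed.

Lemma soft_ge eta y : 0 < eta -> y - eta <= soft eta y.
Proof.
move=> e0; rewrite /soft ler_pdivlMr//.
have := le_trans (ler_norm _) (q_norm y e0); rewrite /q; lra.
Qed.

Lemma soft_le eta y : 0 < eta -> eta <= 1 -> 0 <= y -> soft eta y <= y + eta.
Proof.
move=> e0 e1 y0; rewrite /soft ler_pdivrMr//.
have := q_le y e0; rewrite /q.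
have : `|y - eta| <= y + eta.
  by rewrite (le_trans (ler_normB _ _))// !ger0_norm// ltW.
have : eta ^+ 2 <= eta by rewrite expr2 ger_pMr.
lra.
Qed.

Lemma soft_le_eta eta y : 0 < eta -> eta <= 1 -> y <= 0 -> soft eta y <= eta.
Proof.
move=> e0 e1 y0; rewrite /soft ler_pdivrMr//.
have := q_le y e0; rewrite /q.
have -> : `|y - eta| = - (y - eta) by rewrite ler0_norm// subr_le0; lra.
have : eta ^+ 2 <= eta by rewrite expr2 ger_pMr.
lra.
Qed.

Lemma dsoft_ge0 eta y : 0 < eta -> 0 <= dsoft eta y.
Proof.
move=> e0; rewrite divr_ge0// -lerBlDl sub0r ler_pdivlMr ?q_gt0// mulN1r.
by rewrite lerNl (le_trans _ (q_norm y e0))// -normrN ler_norm.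
Qed.

Lemma dsoft_le1 eta y : 0 < eta -> dsoft eta y <= 1.
Proof.
move=> e0; rewrite ler_pdivrMr// mul1r lerD2l ler_pdivrMr ?q_gt0// mul1r.
exact: le_trans (ler_norm _) (q_norm y e0).
Qed.

(** With [z = y - eta] and [r] the root, the derivative is [(r + z) / (2 r)], and
    [(r + z) (r - z) = eta ^+ 4]. For [y <= 0] one has [r >= eta] and [r - z >= 2 eta], which makes
    the quotient small. *)
Lemma dsoft_le_eta eta y : 0 < eta -> eta <= 1 -> y <= 0 -> dsoft eta y <= eta.
Proof.
move=> e0 e1 y0; have q0 := q_gt0 y e0; have qq := q2 y e0.
rewrite /dsoft -/(q eta y) ler_pdivrMr//; set r := q eta y in q0 qq *.
have -> : 1 + (y - eta) / r = (r + (y - eta)) / r by field; rewrite gt_eqF.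
rewrite ler_pdivrMr//.
have rz : eta <= r.
  apply: le_trans (q_norm y e0); rewrite ler0_norm//; lra.
have hm : (r + (y - eta)) * (2 * eta) <= eta ^+ 4.
  have -> : eta ^+ 4 = (r + (y - eta)) * (r - (y - eta)).
    by transitivity (r * r - (y - eta) * (y - eta)); [rewrite qq|]; ring.
  apply: ler_wpM2l; last by lra.
  have := q_norm y e0; rewrite -/r ler0_norm; lra.
have e3 : eta ^+ 4 <= eta ^+ 2 * eta.
  rewrite -exprSr [leLHS]exprS ler_piMl// exprn_ge0//; exact: ltW.
have e2r : eta ^+ 2 * eta <= eta ^+ 2 * r by rewrite ler_wpM2l// sqr_ge0.
rewrite -(ler_pM2r (x := 2 * eta)); last by rewrite mulr_gt0.
apply: (le_trans hm); apply: (le_trans e3); apply: (le_trans e2r).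
have -> : eta * 2 * r * (2 * eta) = 4 * (eta ^+ 2 * r) by ring.
by rewrite ler_peMl ?ler1n// mulr_ge0 ?sqr_ge0// ltW.
Qed.

End soft_positive_part.

(** * The vector fields tested against the weak gradient of the weight *)

Section radial_field.
Context (R : realType) (N : nat).
Local Notation V := 'rV[R]_N.
Variables (a : V) (eps rho eta : R) (eps_gt0 : 0 < eps) (eta_gt0 : 0 < eta).
Implicit Types (u : V -> R) (x : V).

Definition reg_sq x := eps + dotr (x - a) (x - a).

Definition cutoff_inv x := (reg_sq x)^-1 - rho.

(** Component [j] of [u^2 P (x - a)], where [P] is the smoothed cutoff. The square is spelled as a
    product so that the constructors of [elementary] apply. *)
Definition radial_field u (j : 'I_N) x :=
  u x * u x * (soft eta (cutoff_inv x) * (x - a) ord0 j).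

Lemma reg_sq_gt0 x : 0 < reg_sq x.
Proof. by rewrite ltr_wpDr// dotr_ge0. Qed.

Lemma elementary_sum u (I : Type) (r : seq I) (F : I -> V -> R) :
  (forall i, elementary u (F i)) -> elementary u (fun x => \sum_(i <- r) F i x).
Proof.
move=> eF; elim: r => [|i r IH].
  by under eq_fun do rewrite big_nil; exact: elem_cst.
by under eq_fun do rewrite big_cons; exact: elem_add.
Qed.

Lemma elementary_shift u j : elementary u (fun x => (x - a) ord0 j).
Proof.
under eq_fun do rewrite !mxE.
by apply: elem_add; [exact: elem_coord|exact: elem_cst].
Qed.

Lemma elementary_radial_field u j : elementary u (radial_field u j).
Proof.
apply: elem_mul; first by apply: elem_mul; exact: (elem_base u [::]).
apply: elem_mul; last exact: elementary_shift.
have ez : elementary u (fun x => cutoff_inv x - eta).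
  apply: elem_add; last exact: elem_cst.
  apply: elem_add; last exact: elem_cst.
  apply: elem_inv => [x|]; first by rewrite gt_eqF// reg_sq_gt0.
  apply: elem_add; first exact: elem_cst.
  by apply: elementary_sum => i; apply: elem_mul; exact: elementary_shift.
apply: elem_mul; last exact: elem_cst.
apply: elem_add => //; apply: elem_sqrt => [x|].
  by rewrite ltr_wpDl ?exprn_gt0// -expr2 sqr_ge0.
by apply: elem_add; [exact: elem_mul|exact: elem_cst].
Qed.

Lemma test_radial_field u j : test_function u -> test_function (radial_field u j).
Proof.
move=> [su cu]; split; last first.
  by apply: cpt_supp_sub cu => x ux; rewrite /radial_field ux !mul0r.
by apply: elementary_smooth su _; exact: elementary_radial_field.
Qed.

Lemma is_derive_shift_coord x j i :
  is_derive x (delta_mx ord0 j) (fun y : V => (y - a) ord0 i) ((i == j)%:R).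
Proof.
have := is_derive_coord x (delta_mx ord0 j) i; rewrite mxE eqxx/= => h.
under eq_fun do rewrite !mxE.
by apply: is_derive_eq; rewrite /= subr0.
Qed.

Lemma is_derive_reg_sq x j :
  is_derive x (delta_mx ord0 j) reg_sq (2 * (x - a) ord0 j).
Proof.
have h i : is_derive x (delta_mx ord0 j)
    (fun y : V => (y - a) ord0 i * (y - a) ord0 i)
    (2 * ((x - a) ord0 i * (i == j)%:R)).
  have hi := is_derive_shift_coord x j i.
  by apply: is_derive_eq; rewrite /GRing.scale/=; ring.
have -> : reg_sq = cst eps + \sum_(i < N)
    (fun y : V => (y - a) ord0 i * (y - a) ord0 i).
  by apply/funext => y; rewrite /reg_sq /dotr /= fctE fct_sumE.
apply: is_derive_eq; rewrite add0r -mulr_sumr; congr (_ * _).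
rewrite (bigD1 j)//= eqxx mulr1 big1 ?addr0// => i /negPf ->.
by rewrite mulr0.
Qed.

Lemma partial_radial_field u x j : test_function u ->
  partial j (radial_field u j) x =
  2 * u x * soft eta (cutoff_inv x) * (partial j u x * (x - a) ord0 j)
  - 2 * u x ^+ 2 * dsoft eta (cutoff_inv x) / reg_sq x ^+ 2
    * ((x - a) ord0 j * (x - a) ord0 j)
  + u x ^+ 2 * soft eta (cutoff_inv x).
Proof.
move=> [su _].
have du : is_derive x (delta_mx ord0 j) u (partial j u x).
  by apply: derivableP; exact: (su [::]).2.
have t0 := reg_sq_gt0 x.
have dt := is_derive_inv (negbT (gt_eqF t0)) (is_derive_reg_sq x j).
have dy : is_derive x (delta_mx ord0 j) cutoff_inv
    (- reg_sq x ^- 2 * (2 * (x - a) ord0 j)).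
  rewrite /cutoff_inv; apply: is_derive_eq; by rewrite /= subr0.
have dp := is_derive_comp (is_derive_soft (cutoff_inv x) eta_gt0) dy.
have := is_derive_shift_coord x j j; rewrite eqxx => ds.
have dP : is_derive x (delta_mx ord0 j) (radial_field u j) _ :=
  is_deriveM (is_deriveM du du) (is_deriveM dp ds).
rewrite /partial derive_val /GRing.scale/= -/(partial j u x) !mulrfctE/=.
by field; rewrite gt_eqF.
Qed.

(** The three terms come from the gradient of [u^2], from the gradient [-2 (x - a) / t^2] of [1 / t]
    with [t = reg_sq x], and from the divergence [N] of [x - a]. *)
Lemma divergence_radial_field u x : test_function u ->
  \sum_(j < N) partial j (radial_field u j) x =
  2 * u x * soft eta (cutoff_inv x) * dotr (grad u x) (x - a)
  - 2 * u x ^+ 2 * dsoft eta (cutoff_inv x) / reg_sq x ^+ 2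
    * dotr (x - a) (x - a)
  + N%:R * (u x ^+ 2 * soft eta (cutoff_inv x)).
Proof.
move=> tu; under eq_bigr do rewrite partial_radial_field//.
rewrite !big_split/= sumrN sumr_const card_ord -!mulr_sumr.
have -> : dotr (grad u x) (x - a) =
  \sum_(j < N) partial j u x * (x - a) ord0 j.
  by apply: eq_bigr => j _; rewrite [grad _ _ _ _]mxE.
by rewrite [N%:R * _]mulr_natl.
Qed.

End radial_field.

(** * Pointwise bounds at one pole: [t = eps + |x - a|^2], [s = |x - a|^2], with [p] and [d] the
    values of [soft] and [dsoft] *)

Section one_pole.
Context (R : realType).
Variables (t s rho eta p d b m : R).
Hypotheses (t_gt0 : 0 < t) (s_ge0 : 0 <= s) (s_le : s <= t).
Hypotheses (rho_gt0 : 0 < rho) (eta_gt0 : 0 < eta) (eta_le1 : eta <= 1).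
Hypotheses (b_ge0 : 0 <= b) (m_ge0 : 0 <= m) (p_ge0 : 0 <= p) (d_ge0 : 0 <= d).

Let t1 : 0 <= t^-1. Proof. by rewrite invr_ge0 ltW. Qed.

Let st2 : s / t ^+ 2 <= t^-1.
Proof.
by rewrite expr2 invfM mulrA ler_piMl// ler_pdivrMr// mul1r.
Qed.

Let st2_ge0 : 0 <= s / t ^+ 2.
Proof. by rewrite divr_ge0// sqr_ge0. Qed.

(* [b (m + 2) y - 2 b / t - b^2 t y^2] with [y = 1 / t - rho] is at least
   [b (m - b) / t - (b (m - b) + 2 b) rho]. *)
Lemma inner_profile : rho <= t^-1 -> t^-1 - rho - eta <= p ->
  p <= t^-1 - rho + eta -> d <= 1 ->
  b * (m - b) * t^-1 - (b * (m - b) + 2 * b) * rho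
    - eta * (b * (m + 2) + b ^+ 2 * (2 + s))
  <= b * (m + 2) * p - 2 * b * (d * (s / t ^+ 2)) - b ^+ 2 * (p ^+ 2 * s).
Proof.
move=> rt lp pl d1; set y := t^-1 - rho in lp pl.
have y0 : 0 <= y by rewrite subr_ge0.
have tt : t * t^-1 = 1 by rewrite mulfV// gt_eqF.
have h1 : b * (m + 2) * (y - eta) <= b * (m + 2) * p.
  by rewrite ler_wpM2l// mulr_ge0// addr_ge0.
have h2 : 2 * b * (d * (s / t ^+ 2)) <= 2 * b * t^-1.
  rewrite ler_wpM2l ?mulr_ge0//; apply: le_trans st2.
  by rewrite ler_piMl.
(* From [s <= t] follow [y s <= 1 - rho t <= 1] and [y^2 s <= y (1 - rho t) <= y]; expanding
   [(y + eta)^2 s] then costs at most [eta (2 + s)] beyond [y]. *)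
have h3 : p ^+ 2 * s <= t^-1 - rho + eta * (2 + s).
  have pp : p ^+ 2 * s <= (y + eta) ^+ 2 * s.
    have ye0 : 0 <= y + eta by rewrite addr_ge0// ltW.
    by rewrite ler_wpM2r// lerXn2r ?nnegrE.
  apply: (le_trans pp).
  have ys : y * s <= 1.
    apply: (@le_trans _ _ (t^-1 * t)); last by rewrite mulrC tt.
    by rewrite ler_pM// lerBlDr lerDl ltW.
  have yys : y ^+ 2 * s <= t^-1 - rho.
    apply: (@le_trans _ _ (y ^+ 2 * t)); first by rewrite ler_wpM2l// sqr_ge0.
    have yt : y * t = 1 - rho * t by rewrite /y mulrBl [t^-1 * t]mulrC tt.
    rewrite expr2 -mulrA yt.
    by rewrite ler_piMr// lerBlDr lerDl mulr_ge0// ltW.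
  have ees : eta ^+ 2 * s <= eta * s.
    by rewrite ler_wpM2r// expr2 ler_piMl// ltW.
  have eys : eta * (y * s) <= eta by rewrite ler_piMr// ltW.
  have -> : (y + eta) ^+ 2 * s =
    y ^+ 2 * s + 2 * (eta * (y * s)) + eta ^+ 2 * s by ring.
  lra.
have h4 : b ^+ 2 * (p ^+ 2 * s) <= b ^+ 2 * (t^-1 - rho + eta * (2 + s)).
  by rewrite ler_wpM2l// sqr_ge0.
have -> : b * (m - b) * t^-1 - (b * (m - b) + 2 * b) * rho
    - eta * (b * (m + 2) + b ^+ 2 * (2 + s)) =
    b * (m + 2) * (y - eta) - 2 * b * t^-1
    - b ^+ 2 * (t^-1 - rho + eta * (2 + s)) by rewrite /y; ring.
by apply: lerB => //; apply: lerB.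
Qed.

Variables (u M D w g k2 dim H : R).
Hypotheses (M_ge0 : 0 <= M) (dimE : dim + k2 = m + 2) (dim_ge0 : 0 <= dim).
Hypothesis D_square : forall r : R, 0 <= D + 2 * r * w + r ^+ 2 * s.
Hypothesis gH : `|g * u ^+ 2| <= H.

(* [M] is the weight, [D = |grad u|^2], [w = grad u . (x - a)] and
   [g = (x - a) . grad mu]. *)
Definition pole_flux := M * (2 * u * p * w - 2 * u ^+ 2 * d / t ^+ 2 * s
  + dim * (u ^+ 2 * p)) + g * u ^+ 2 * p.

(** A single coefficient of [eta] that serves both inside and outside the ball. It does not involve
    [eta] itself, nor [p] and [d], so one integrable function dominates the errors for all [eta]. *)
Definition pole_error :=
  (b * (m + 2) + b ^+ 2 * (2 + s)) * (u ^+ 2 * M)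
  + b * (M * (D + u ^+ 2 * s) + 2 * rho * (u ^+ 2 * M) + H).

Let uM_ge0 : 0 <= u ^+ 2 * M. Proof. by rewrite mulr_ge0// sqr_ge0. Qed.

Let D_ge0 : 0 <= D.
Proof. by have := D_square 0; rewrite mulr0 mul0r expr0n/= mul0r !addr0. Qed.

Let H_ge0 : 0 <= H. Proof. exact: le_trans (normr_ge0 _) gH. Qed.

(** Three inequalities add up: [inner_profile] times [u^2 M], the completed square at [r = b p u]
    times [M], and [k2 M <= g] times [b u^2 p]. The dimension and [k2] merge through
    [dim + k2 = m + 2]. *)
Lemma inner_pole : rho <= t^-1 -> t^-1 - rho - eta <= p ->
  p <= t^-1 - rho + eta -> d <= 1 -> k2 * M <= g ->
  b * (m - b) * (u ^+ 2 * M / t) <= D * M + b * pole_flux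
    + (b * (m - b) + 2 * b) * rho * (u ^+ 2 * M) + eta * pole_error.
Proof.
move=> rt lp pl d1 gk.
have ip := ler_wpM2r uM_ge0 (inner_profile rt lp pl d1).
have sq : 0 <= (D + 2 * (b * p * u) * w + (b * p * u) ^+ 2 * s) * M.
  by rewrite mulr_ge0.
have gk' : b * (u ^+ 2 * p) * (k2 * M) <= b * (u ^+ 2 * p) * g.
  by rewrite ler_wpM2l// mulr_ge0// mulr_ge0// sqr_ge0.
have e0 : 0 <= eta * (b * (M * (D + u ^+ 2 * s) + 2 * rho * (u ^+ 2 * M) + H)).
  rewrite mulr_ge0 ?(ltW eta_gt0)// mulr_ge0// !addr_ge0//.
    by rewrite mulr_ge0// addr_ge0// mulr_ge0// sqr_ge0.
  by rewrite mulr_ge0// mulr_ge0// ltW.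
have k2E : k2 = m + 2 - dim by rewrite -dimE; ring.
rewrite /pole_error; move: ip sq gk' e0.
rewrite /pole_flux k2E; set v := t^-1.
have -> : 2 * u ^+ 2 * d / t ^+ 2 * s = 2 * u ^+ 2 * (d * (s / t ^+ 2)) by ring.
set ds := d * _; lra.
Qed.

(** The energy [D * M] is not spent here, being reserved for the pole whose ball contains the point.
    Apart from [1 / t <= rho], all losses go into [eta * pole_error]: the cross term through the
    square at [r = u] and [p <= eta], the profile term through [d <= eta] and [s / t^2 <= rho], and
    the term in [g], whose sign is unknown, through [H]. *)
Lemma outer_pole : t^-1 <= rho -> p <= eta -> d <= eta ->
  0 <= b * (m - b) ->
  b * (m - b) * (u ^+ 2 * M / t) <= b * (m - b) * rho * (u ^+ 2 * M)
    + b * pole_flux + eta * pole_error.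
Proof.
move=> tr pe de c0.
have h1 : b * (m - b) * (u ^+ 2 * M / t) <= b * (m - b) * rho * (u ^+ 2 * M).
  by rewrite -[leRHS]mulrA ler_wpM2l// [leLHS]mulrC ler_wpM2r.
have h2 : 0 <= b * (p * M * (D + 2 * u * w + u ^+ 2 * s)).
  by rewrite mulr_ge0// mulr_ge0// mulr_ge0.
have h3 : b * (p * (M * (D + u ^+ 2 * s))) <= b * (eta * (M * (D + u ^+ 2 * s))).
  by rewrite ler_wpM2l// ler_wpM2r// mulr_ge0// addr_ge0// mulr_ge0// sqr_ge0.
have h4 : b * (2 * (u ^+ 2 * M) * (d * (s / t ^+ 2))) <=
    b * (2 * (u ^+ 2 * M) * (eta * rho)).
  have uM2 : 0 <= 2 * (u ^+ 2 * M) by rewrite mulr_ge0.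
  by rewrite ler_wpM2l// (ler_wpM2l uM2)// ler_pM// (le_trans st2 tr).
have h5 : - (b * (eta * H)) <= b * (p * (g * u ^+ 2)).
  rewrite -mulrN ler_wpM2l// lerNl -mulrN.
  apply: (@le_trans _ _ (p * H)); last by rewrite ler_wpM2r.
  by rewrite ler_wpM2l// (le_trans _ gH)// -normrN ler_norm.
have h6 : 0 <= b * (M * (dim * (u ^+ 2 * p))).
  by rewrite mulr_ge0// mulr_ge0// mulr_ge0// mulr_ge0// sqr_ge0.
have h7 : 0 <= eta * ((b * (m + 2) + b ^+ 2 * (2 + s)) * (u ^+ 2 * M)).
  rewrite mulr_ge0 ?(ltW eta_gt0)// mulr_ge0// addr_ge0//.
    by rewrite mulr_ge0// addr_ge0.
  by rewrite mulr_ge0 ?sqr_ge0// addr_ge0.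
rewrite /pole_error; move: h1 h2 h3 h4 h5 h6 h7; rewrite /pole_flux.
have -> : 2 * u ^+ 2 * d / t ^+ 2 * s = 2 * u ^+ 2 * (d * (s / t ^+ 2)) by ring.
set ds := d * _; lra.
Qed.

End one_pole.

(** At most one index is inner, so [D] and the surplus [2 b U] are spent at most once. The total
    [n c U + 2 b U] is then at most [(1 + (n + 1) c) U] by [2 b <= 1 + c]; this is the origin of
    [k0 = 1] and of the factor [n + 1]. *)
Lemma sum_poles (R : realType) (n : nat) (outer : pred 'I_n)
    (A F E : 'I_n -> R) (D b c U : R) :
  0 <= D -> 0 <= U -> 0 <= b -> 2 * b <= 1 + c ->
  (forall i, outer i -> A i <= c * U + F i + E i) ->
  (forall i, ~~ outer i -> A i <= D + F i + (c + 2 * b) * U + E i) ->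
  (forall i j, i != j -> ~~ outer i -> outer j) ->
  \sum_(i < n) A i <=
  D + (1 + n.+1%:R * c) * U + \sum_(i < n) F i + \sum_(i < n) E i.
Proof.
move=> D0 U0 b0 bc Aout Ain excl.
pose T i := c * U + F i + E i.
have sT : \sum_(i < n) T i =
    n%:R * (c * U) + \sum_(i < n) F i + \sum_(i < n) E i.
  by rewrite !big_split/= sumr_const card_ord mulr_natl.
have nS : n.+1%:R = n%:R + 1 :> R by rewrite -natr1.
have bU : 2 * b * U <= (1 + c) * U by rewrite ler_wpM2r.
case: (pickP (fun i => ~~ outer i)) => [i oi|out].
  have : \sum_(j < n) A j <= D + 2 * b * U + \sum_(j < n) T j.
    rewrite (bigD1 i)//= [X in _ <= _ + X](bigD1 i)//= addrA.
    apply: lerD; first by have := Ain i oi; rewrite /T; lra.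
    apply: ler_sum => j ji; apply: Aout; apply: excl oi.
    by rewrite eq_sym.
  rewrite sT nS; lra.
have : \sum_(j < n) A j <= \sum_(j < n) T j.
  by apply: ler_sum => j _; apply: Aout; exact/negbFE/out.
have bU0 : 0 <= 2 * b * U by rewrite !mulr_ge0.
rewrite sT nS; lra.
Qed.

(** * Integrability of real-valued functions *)

Section real_integrable.
Context d (T : measurableType d) (R : realType).
Variable m : {measure set T -> \bar R}.
Implicit Types f g : T -> R.

Definition integrable_real f := m.-integrable setT (EFin \o f).

Lemma integrable_realD f g : integrable_real f -> integrable_real g ->
  integrable_real (fun x => f x + g x).
Proof. by move=> fi gi; exact: (integrableD measurableT fi gi). Qed.

Lemma integrable_realZ r f : integrable_real f ->
  integrable_real (fun x => r * f x).
Proof. by move=> fi; exact: (integrableZl measurableT r fi). Qed.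

Lemma integrable_real_sum (I : Type) (s : seq I) (F : I -> T -> R) :
  (forall i, integrable_real (F i)) ->
  integrable_real (fun x => \sum_(i <- s) F i x).
Proof.
move=> iF; have := @integrable_sum _ _ _ m _ measurableT _ s xpredT
  (fun i => EFin \o F i) (fun i _ => iF i).
by apply: eq_integrable => // x _ /=; rewrite sumEFin.
Qed.

End real_integrable.

(** * Quadratic identities for the Euclidean product *)

Section dotr_identities.
Context (R : realType) (N : nat).
Implicit Types x y z : 'rV[R]_N.

Lemma dotr_addZ x z (r : R) :
  dotr (x + r *: z) (x + r *: z) =
  dotr x x + 2 * r * dotr x z + r ^+ 2 * dotr z z.
Proof.
rewrite /dotr !mulr_sumr -!big_split/=; apply: eq_bigr => i _.
by rewrite !mxE; ring.
Qed.

Lemma dotr_sub_le x y : dotr (x - y) (x - y) <= 2 * (dotr x x + dotr y y).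
Proof.
have := dotr_ge0 (x + 1 *: y); rewrite dotr_addZ.
have -> : x - y = x + (-1) *: y by rewrite scaleN1r.
rewrite dotr_addZ; lra.
Qed.

End dotr_identities.

(** * The regularized inequality for test functions *)

Section test_functions.
Context (R : realType) (N n : nat).
Local Notation V := 'rV[R]_N.
Local Notation leb := (lebesgue_rV R N).
Variables (a : 'I_n -> V) (r0 : R) (mu : V -> R) (Dmu : V -> V) (k2 b : R).
Hypotheses (r0_gt0 : 0 < r0) (mu_ge0 : forall x, 0 <= mu x).
Hypothesis a_sep : forall i j, i != j ->
  4 * r0 ^+ 2 <= dotr (a i - a j) (a i - a j).
Hypothesis wmu : is_weak_grad mu Dmu.
Hypothesis Dmu_ge : forall i, {ae leb, forall x, eball (a i) r0 x ->
  k2 * mu x <= dotr (x - a i) (Dmu x)}.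

Let m := N%:R + k2 - 2.
Let c := b * (m - b).

Hypotheses (m_ge0 : 0 <= m) (b_ge0 : 0 <= b) (c_ge0 : 0 <= c).
Hypothesis bc : 2 * b <= 1 + c.
Variables (u : V -> R) (eps : R).
Hypotheses (tu : test_function u) (eps_gt0 : 0 < eps).

Let rho := (r0 ^+ 2)^-1.
Let rho_gt0 : 0 < rho. Proof. by rewrite invr_gt0 exprn_gt0. Qed.

Let t i := reg_sq (a i) eps.
Let s i x := dotr (x - a i) (x - a i).
Let D x := dotr (grad u x) (grad u x).
Let H i x := \sum_(j < N) `|Dmu x ord0 j * (u x ^+ 2 * (x - a i) ord0 j)|.
Let E x := \sum_(i < n) pole_error (s i x) rho b m (u x) (mu x) (D x) (H i x).
Let Psi eta i := radial_field (a i) eps rho eta u.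
Let S eta i x :=
  \sum_(j < N) (mu x * partial j (Psi eta i j) x + Dmu x ord0 j * Psi eta i j x).
Let A x := \sum_(i < n) u x ^+ 2 * mu x / t i x.

Let t_gt0 i x : 0 < t i x. Proof. exact: reg_sq_gt0. Qed.

Let s_le i x : s i x <= t i x.
Proof. by rewrite /t /reg_sq lerDr ltW. Qed.

Lemma flux_radial_field eta i x : 0 < eta ->
  S eta i x = pole_flux (t i x) (s i x) (soft eta ((t i x)^-1 - rho))
    (dsoft eta ((t i x)^-1 - rho)) (u x) (mu x) (dotr (grad u x) (x - a i))
    (dotr (x - a i) (Dmu x)) N%:R.
Proof.
move=> eta0; rewrite /S big_split/= -mulr_sumr divergence_radial_field//.
rewrite /pole_flux; congr (_ + _).
rewrite /dotr !mulr_suml; apply: eq_bigr => j _.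
by rewrite /Psi /radial_field /cutoff_inv -/(t i); ring.
Qed.

Let out x i := (t i x)^-1 <= rho.

(** If [t i x < r0 ^+ 2], then [4 r0^2 <= |a_i - a_j|^2 <= 2 (|x - a_i|^2 + |x - a_j|^2)] forces
    [|x - a_j|^2] above [r0^2]. Working with squares avoids the triangle inequality for [enorm]. *)
Lemma out_exclusive x i j : i != j -> ~~ out x i -> out x j.
Proof.
move=> ij; rewrite /out -ltNge => ti.
have ti' : t i x < r0 ^+ 2.
  by rewrite -[ltRHS]invrK -/rho -[ltLHS]invrK ltf_pV2// posrE invr_gt0.
have := dotr_sub_le (x - a j) (x - a i).
rewrite opprB [_ + (a i - x)]addrC addrA subrK => h; have := a_sep ij.
have := s_le i x; have := s_le j x; rewrite /s => h1 h2 h3.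
by rewrite /rho lef_pV2 ?posrE ?exprn_gt0//; lra.
Qed.

Lemma pointwise_poles eta x : 0 < eta -> eta <= 1 ->
  (forall i, eball (a i) r0 x -> k2 * mu x <= dotr (x - a i) (Dmu x)) ->
  c * A x <= D x * mu x + (1 + n.+1%:R * c) * rho * (u x ^+ 2 * mu x)
    + b * (\sum_(i < n) S eta i x) + eta * E x.
Proof.
move=> eta0 eta1 hx; rewrite /A /E !mulr_sumr -[_ * rho * _]mulrA.
have Dsq i r : 0 <= D x + 2 * r * dotr (grad u x) (x - a i) + r ^+ 2 * s i x.
  by rewrite -dotr_addZ dotr_ge0.
have gH i : `|dotr (x - a i) (Dmu x) * u x ^+ 2| <= H i x.
  rewrite /dotr mulr_suml (le_trans (ler_norm_sum _ _ _))//.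
  by apply: ler_sum => j _; rewrite le_eqVlt; apply/orP; left; apply/eqP;
    congr `|_|; ring.
have dimE : N%:R + k2 = m + 2 by rewrite /m subrK.
apply: (@sum_poles _ _ (out x) _ _ _ _ b c) => //.
- by rewrite mulr_ge0// dotr_ge0.
- by rewrite mulr_ge0 ?(ltW rho_gt0)// mulr_ge0// sqr_ge0.
- move=> i oi; rewrite flux_radial_field// [_ * (rho * _)]mulrA /c.
  have y0 : (t i x)^-1 - rho <= 0 by rewrite subr_le0.
  apply: outer_pole => //.
  + exact: dotr_ge0.
  + exact: soft_ge0.
  + exact: dsoft_ge0.
  + exact: soft_le_eta.
  + exact: dsoft_le_eta.
- move=> i; rewrite /out -ltNge => oi; rewrite flux_radial_field// [_ * (rho * _)]mulrA /c.
  have y0 : 0 <= (t i x)^-1 - rho by rewrite subr_ge0 ltW.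
  apply: inner_pole dimE _ _ _ _ _ _ _ => //.
  + exact: dotr_ge0.
  + exact: soft_ge0.
  + exact: ltW.
  + exact: soft_ge.
  + exact: soft_le.
  + exact: dsoft_le1.
  (* An inner index has [|x - a_i|^2 <= t i x < r0 ^+ 2], so [x] lies in the ball where the lower
     bound on the radial derivative is available. *)
  + apply: hx; rewrite /eball/= -(ltr_pXn2r (n := 2)) ?nnegrE ?sqrtr_ge0 ?ltW//.
    rewrite enorm2; apply: le_lt_trans (s_le i x) _.
    by rewrite -[ltRHS]invrK -/rho -[ltLHS]invrK ltf_pV2// posrE invr_gt0.
- exact: out_exclusive.
Qed.

Local Notation int_real := (integrable_real leb).

Lemma integrable_weighted g : elementary u g -> cpt_supp g ->
  int_real (fun x => g x * mu x).
Proof.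
move=> eg cg; have [lmu _ _] := wmu.
have sg : smooth g by case: tu => su _; exact: elementary_smooth eg.
have := L1loc_integrableM lmu (sg [::]).1 cg.
by apply: eq_integrable => // x _ /=; rewrite mulrC.
Qed.

Lemma integrable_weighted_mul g : elementary u g ->
  int_real (fun x => u x ^+ 2 * g x * mu x).
Proof.
move=> eg; have eu : elementary u u by exact: (elem_base u [::]).
have := @integrable_weighted (fun x => u x * u x * g x) (elem_mul (elem_mul eu eu) eg).
apply; apply: cpt_supp_sub tu.2 => x ->; by rewrite mul0r mul0r.
Qed.

Let intU : int_real (fun x => u x ^+ 2 * mu x).
Proof.
have := integrable_weighted_mul (elem_cst u 1).
by apply: eq_integrable => // x _ /=; rewrite mulr1.
Qed.

Let elem_s i : elementary u (s i).
Proof. by apply: elementary_sum => j; apply: elem_mul; exact: elementary_shift. Qed.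

Let intA : int_real A.
Proof.
apply: integrable_real_sum => i.
have eg : elementary u (fun x => (t i x)^-1).
  apply: elem_inv => [x|]; first by rewrite gt_eqF.
  by apply: elem_add; [exact: elem_cst|exact: elem_s].
have := integrable_weighted_mul eg.
by apply: eq_integrable => // x _ /=; rewrite mulrAC.
Qed.

Let intD : int_real (fun x => D x * mu x).
Proof.
have : int_real (fun x => \sum_(j < N) partial j u x * partial j u x * mu x).
  apply: integrable_real_sum => j.
  have eu : elementary u (partial j u) by exact: (elem_base u [:: j]).
  apply: (integrable_weighted (elem_mul eu eu)).
  have cj : cpt_supp (partial j u) := cpt_supp_partial tu.2.
  by apply: (cpt_supp_sub _ cj) => x ->; rewrite mul0r.
apply: eq_integrable => // x _ /=; rewrite /D /dotr mulr_suml.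
by congr EFin; apply: eq_bigr => j _; rewrite !mxE.
Qed.

Let intH i : int_real (H i).
Proof.
apply: integrable_real_sum => j; apply: integrable_norm => //.
have [_ lD _] := wmu; apply: L1loc_integrableM; first exact: lD.
  have eu : elementary u u by exact: (elem_base u [::]).
  have eg := elem_mul (elem_mul eu eu) (elementary_shift (a i) u j).
  by case: tu => su _; exact: (elementary_smooth su eg [::]).1.
by apply: cpt_supp_sub tu.2 => x ->; rewrite expr0n/= mul0r.
Qed.

Let intE : int_real E.
Proof.
apply: integrable_real_sum => i.
have eg : elementary u (fun x => b * (m + 2) + b ^+ 2 * (2 + s i x)
    + (b * s i x + 2 * b * rho)).
  apply: elem_add; apply: elem_add; try exact: elem_cst.
    apply: elem_mul; first exact: elem_cst.
    by apply: elem_add => //; exact: elem_cst.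
  by apply: elem_mul => //; exact: elem_cst.
have := integrable_realD (integrable_weighted_mul eg)
  (integrable_realZ b (integrable_realD intD (intH i))).
by apply: eq_integrable => // x _ /=; rewrite /pole_error; congr EFin; ring.
Qed.

(** Integrating [pointwise_poles] removes the fluxes [S eta i], whose integrals vanish by
    [weak_divergence]. What remains is nonnegativity of the integral of [G] up to [eta] times the
    fixed number [\int E]. *)
Lemma hardy_test_real :
  c * \int[leb]_x A x <= \int[leb]_x (D x * mu x)
    + (1 + n.+1%:R * c) * rho * \int[leb]_x (u x ^+ 2 * mu x).
Proof.
set K := (1 + _) * rho.
pose G x := D x * mu x + K * (u x ^+ 2 * mu x) + (- c) * A x.
have intG : int_real G.
  by do 2?apply: integrable_realD => //; exact: integrable_realZ.
have GE : \int[leb]_x G x = \int[leb]_x (D x * mu x)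
    + K * \int[leb]_x (u x ^+ 2 * mu x) + (- c) * \int[leb]_x A x.
  rewrite RintegralD//; last exact: integrable_realZ.
    by rewrite RintegralD//; [rewrite !RintegralZl|exact: integrable_realZ].
  by apply: integrable_realD => //; exact: integrable_realZ.
suff : 0 <= \int[leb]_x G x by rewrite GE mulNr subr_ge0.
have ae_pole : {ae leb, forall x, forall i, eball (a i) r0 x ->
    k2 * mu x <= dotr (x - a i) (Dmu x)}.
  exact: (@filter_forall V _ (fun i x => eball (a i) r0 x ->
    k2 * mu x <= dotr (x - a i) (Dmu x)) _ (ae_filter_ringOfSetsType leb)).
have lower eta : 0 < eta -> eta <= 1 ->
    0 <= \int[leb]_x G x + eta * \int[leb]_x E x.
  move=> e0 e1; pose S' x := \sum_(i < n) S eta i x.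
  have SP i : int_real (S eta i) /\ \int[leb]_x S eta i x = 0.
    by apply: weak_divergence => // j; exact: test_radial_field.
  have intS : int_real S' by apply: integrable_real_sum => i; have [] := SP i.
  have S0 : \int[leb]_x S' x = 0.
    rewrite /Rintegral /S'; under eq_integral do rewrite -sumEFin.
    rewrite integral_sum//; last by move=> i; have [] := SP i.
    rewrite big1// => i _; have [iS iS0] := SP i.
    by rewrite -[LHS]fineK; [rewrite -[fine _]/(Rintegral _ _ _) iS0|
      exact: integrable_fin_num].
  have intT : int_real (fun x => b * S' x + eta * E x).
    by apply: integrable_realD; exact: integrable_realZ.
  have -> : \int[leb]_x G x + eta * \int[leb]_x E x =
      \int[leb]_x (G x + (b * S' x + eta * E x)).
    rewrite (@RintegralD _ _ _ leb _ G (fun x => b * S' x + eta * E x))//.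
    rewrite (@RintegralD _ _ _ leb _ (fun x => b * S' x) (fun x => eta * E x))//.
    - by rewrite !RintegralZl// S0 mulr0 add0r.
    - exact: integrable_realZ.
    - exact: integrable_realZ.
  apply: Rintegral_ae_ge0.
    have /integrableP[/measurable_EFinP] := integrable_realD intG intT.
    by [].
  apply: filterS ae_pole => x /(pointwise_poles e0 e1).
  by rewrite /G /S' /K; lra.
rewrite leNgt; apply/negP => G0.
set g := \int[leb]_x G x in G0 lower; set e := \int[leb]_x E x in lower.
(* If [g < 0], this [eta] makes [eta * e] at most [- g / 2], so [lower] would give [0 <= g / 2]. The
   [+ 1] keeps the divisor positive. *)
pose eta := Num.min 1 (- g / (2 * (`|e| + 1))).
have e1 : 0 < `|e| + 1 by rewrite ltr_wpDl.
have eta0 : 0 < eta by rewrite lt_min ltr01/= divr_gt0 ?mulr_gt0// oppr_gt0.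
have eta1 : eta <= 1 by rewrite ge_min lexx.
have := lower eta eta0 eta1.
have : eta * e <= eta * (`|e| + 1).
  by rewrite ler_pM2l// (le_trans (ler_norm _))// lerDl.
have : eta * (`|e| + 1) <= - g / 2.
  rewrite -ler_pdivlMr// -mulrA -invfM ge_min.
  by apply/orP; right.
lra.
Qed.

Lemma hardy_test :
  (c%:E * wint mu (fun x => \sum_(i < n) u x ^+ 2 / reg_sq (a i) eps x)%R
   <= wint mu (fun x => enorm (grad u x) ^+ 2)%R
      + ((1 + n.+1%:R * c) / r0 ^+ 2)%:E * wint mu (fun x => u x ^+ 2)%R)%E.
Proof.
have wE f : int_real f -> (\int[leb]_x (f x)%:E = (\int[leb]_x f x)%:E)%E.
  by move=> intf; rewrite fineK//; exact: integrable_fin_num.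
have -> : wint mu (fun x => \sum_(i < n) u x ^+ 2 / reg_sq (a i) eps x) =
    (\int[leb]_x A x)%:E.
  rewrite -wE//; apply: eq_integral => x _; congr EFin.
  by rewrite mulr_suml; apply: eq_bigr => i _; rewrite mulrAC.
have -> : wint mu (fun x => enorm (grad u x) ^+ 2) =
    (\int[leb]_x (D x * mu x))%:E.
  by rewrite -wE//; apply: eq_integral => x _; rewrite enorm2.
rewrite /wint wE// -!EFinM -EFinD lee_fin.
exact: hardy_test_real.
Qed.

End test_functions.

(** This replaces the limits in [alpha]: they are taken along a sequence, so that only countably
    many null sets are discarded. *)
Lemma archimedean_le0 (R : archiRealFieldType) (x y : R) :
  (forall k : nat, k.+1%:R * x <= y) -> x <= 0.
Proof.
move=> h; rewrite leNgt; apply/negP => x0.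
have := h (Num.truncn (`|y| / x)).
apply/negP; rewrite -ltNge; apply: le_lt_trans (ler_norm y) _.
by rewrite -ltr_pdivrMr// truncnS_gt.
Qed.

(** * Sign conditions extracted from (H2') *)

Section sign_conditions.
Context (R : realType) (N n : nat).
Local Notation V := 'rV[R]_N.
Local Notation leb := (lebesgue_rV R N).
Variables (a : 'I_n -> V) (r0 : R) (mu : V -> R) (Dmu : V -> V) (k1 k2 : R).
Hypotheses (mu_ge0 : forall x, 0 <= mu x) (H2 : hyp_H2 a r0 mu Dmu k1 k2).

Let T i x := 1 + enorm (x - a i) ^+ 2.
Let T_gt0 i x : 0 < T i x. Proof. by rewrite ltr_wpDr// sqr_ge0. Qed.

(** (H2') at [eps = 1], with the positive denominator [T i x] cleared. Only [alpha] varies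
    afterwards. *)
Let H2_at i alpha : alpha < 0 -> {ae leb, forall x, eball (a i) r0 x ->
  alpha * dotr (x - a i) (Dmu x) <= (k1 * T i x + k2 * alpha) * mu x}.
Proof.
move=> al0; have := H2 i al0 ltr01; apply: filterS => x h /h.
rewrite grad_f_epsE// -/(T i x).
have -> : dotr ((alpha / T i x) *: (x - a i)) (Dmu x) =
    alpha * dotr (x - a i) (Dmu x) / T i x.
  rewrite /dotr mulr_sumr mulr_suml; apply: eq_bigr => j _.
  by rewrite mxE; field; rewrite gt_eqF.
rewrite ler_pdivrMr// => {}h; apply: (le_trans h).
rewrite le_eqVlt; apply/orP; left.
by apply/eqP; field; rewrite gt_eqF.
Qed.

(* Let [alpha -> -oo] in (H2'). *)
Lemma radial_derivative_ge i : {ae leb, forall x, eball (a i) r0 x ->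
  k2 * mu x <= dotr (x - a i) (Dmu x)}.
Proof.
have h (k : nat) : {ae leb, forall x, eball (a i) r0 x ->
    - k.+1%:R * dotr (x - a i) (Dmu x) <=
    (k1 * T i x + k2 * - k.+1%:R) * mu x}.
  by apply: H2_at; rewrite oppr_lt0.
have := ae_foralln h; apply: filterS => x hx bx.
rewrite -subr_le0; apply: (@archimedean_le0 R _ (k1 * T i x * mu x)) => k.
by have := hx k bx; lra.
Qed.

(* Let [alpha -> 0] in (H2'); [1 / mu] being locally integrable, [mu] does not
   vanish on a ball. *)
Lemma k1_ge0 (i : 'I_n) : 0 < r0 -> L1loc (fun x => ((mu x)%:E^-1)%E) -> 0 <= k1.
Proof.
move=> r00 lmu; rewrite leNgt; apply/negP => k10.
have h (k : nat) : {ae leb, forall x, eball (a i) r0 x ->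
    - k.+1%:R^-1 * dotr (x - a i) (Dmu x) <=
    (k1 * T i x + k2 * - k.+1%:R^-1) * mu x}.
  by apply: H2_at; rewrite oppr_lt0 invr_gt0.
have mu0 : {ae leb, forall x, eball (a i) r0 x -> mu x = 0}.
  have := ae_foralln h; apply: filterS => x hx bx.
  apply/le_anti; rewrite mu_ge0 andbT.
  (* After multiplication by [k + 1] the terms with [k1] grow linearly in [k] while the others stay
     fixed. *)
  have : - k1 * T i x * mu x <= 0.
    apply: (@archimedean_le0 R _ (dotr (x - a i) (Dmu x) - k2 * mu x)) => k.
    have k0 : 0 < k.+1%:R :> R by [].
    have := hx k bx; rewrite -(ler_pM2l k0).
    set q := k.+1%:R in k0 *; set g := dotr _ _.
    have -> : q * (- q^-1 * g) = - g by field; rewrite gt_eqF.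
    have -> : q * ((k1 * T i x + k2 * - q^-1) * mu x) =
      q * k1 * T i x * mu x - k2 * mu x by field; rewrite gt_eqF.
    lra.
  by rewrite -mulrA pmulr_rle0 ?oppr_gt0// pmulr_rle0.
(* Half side of a cube centred at the pole, whose volume is explicit. It lies in the ball because
   [N * del^2 < (N + 1)^2 * del^2 = r0^2]. *)
pose del := r0 / N.+1%:R.
have del0 : 0 < del by rewrite divr_gt0.
pose lo : V := \row_j (a i ord0 j - del).
pose hi : V := \row_j (a i ord0 j + del).
pose K := [set x : V | forall j, lo ord0 j <= x ord0 j <= hi ord0 j].
have cK : compact K.
  rewrite (_ : K = [set x : V | forall j,
      `[lo ord0 j, hi ord0 j]%classic (x ord0 j)]).
    apply: (@rV_compact R N (fun j => `[lo ord0 j, hi ord0 j]%classic)) => j.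
    exact: segment_compact.
  by apply/seteqP; split=> x /= h' j; have := h' j; rewrite /= in_itv.
have mK := compact_measurable_rV cK.
have Kb : K `<=` eball (a i) r0.
  move=> x Kx; rewrite /eball/= -(ltr_pXn2r (n := 2)) ?nnegrE ?sqrtr_ge0 ?ltW//.
  rewrite enorm2 /dotr.
  have : \sum_(j < N) (x - a i) ord0 j * (x - a i) ord0 j <=
      \sum_(j < N) del ^+ 2.
    apply: ler_sum => j _; have := Kx j; rewrite !mxE => /andP[h1 h2].
    have : 0 <= (del - (x ord0 j - a i ord0 j)) * (del + (x ord0 j - a i ord0 j)).
      by apply: mulr_ge0; lra.
    lra.
  move=> /le_lt_trans; apply; rewrite sumr_const card_ord -mulr_natl.
  have -> : r0 ^+ 2 = N.+1%:R ^+ 2 * del ^+ 2.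
    by rewrite /del; field; rewrite addrC natr1.
  rewrite ltr_pM2r ?exprn_gt0// -natrX ltr_nat.
  by rewrite expnS expn1 (leq_trans (ltnSn N))// leq_pmulr.
have Kpos : (0 < leb K)%E.
  rewrite lebesgue_rV_box => [|j]; last by rewrite !mxE; lra.
  by rewrite lte_fin prodr_gt0// => j _; rewrite !mxE; lra.
(* An integrable function is finite almost everywhere, but [1 / mu] is [+oo] where [mu] vanishes,
   hence almost everywhere on [K]; so [K] would be a null set. *)
have iK := integrable_ae mK (lmu K cK).
have nK : {ae leb, forall x, ~ K x}.
  apply: filterS2 mu0 iK => x m0 f0 Kx.
  by have := f0 Kx; rewrite m0 ?inve0//; exact: Kb.
have [Z [mZ Z0 KZ]] := nK.
suff : (leb K <= 0)%E by rewrite leNgt Kpos.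
by rewrite -Z0; apply: le_measure; rewrite ?inE// => x Kx; apply: KZ => /=; apply.
Qed.

End sign_conditions.

(** Replaces [x] by a nearby [y] at the relative cost [d]; the large factor [1 + d^-1] falls on
    [y - x], which can be made small after [d] is fixed. *)
Lemma sqr_young (R : realFieldType) (d x y : R) : 0 < d ->
  x ^+ 2 <= (1 + d) * y ^+ 2 + (1 + d^-1) * (y - x) ^+ 2.
Proof.
move=> d0; rewrite -subr_ge0.
have -> : (1 + d) * y ^+ 2 + (1 + d^-1) * (y - x) ^+ 2 - x ^+ 2 =
    (d * y + (y - x)) ^+ 2 / d by field; rewrite gt_eqF.
by rewrite divr_ge0 ?sqr_ge0 ?ltW.
Qed.

Lemma enorm_young (R : realType) (N : nat) (d : R) (x y : 'rV[R]_N) : 0 < d ->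
  enorm x ^+ 2 <= (1 + d) * enorm y ^+ 2 + (1 + d^-1) * enorm (y - x) ^+ 2.
Proof.
move=> d0; rewrite !enorm2 /dotr !mulr_sumr -big_split/=.
apply: ler_sum => j _; rewrite !mxE -!expr2; exact: sqr_young.
Qed.

Lemma measurable_funV_pos d (T : measurableType d) (R : realType) (f : T -> R) :
  (forall x, 0 <= f x) -> measurable_fun setT f ->
  measurable_fun setT (fun x => (f x)^-1).
Proof.
move=> f0 mf; rewrite (_ : (fun x => _) = (fun y => y `^ (-1)) \o f).
  by apply: measurableT_comp mf; exact: measurable_powR.
by apply/funext => x; rewrite /= powR_inv1.
Qed.

Lemma limn_einf_le (R : realType) (X : (\bar R)^nat) (B : \bar R) :
  (forall k, X k <= B)%E -> (limn_einf X <= B)%E.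
Proof.
move=> XB; rewrite limn_einf_lim (cvg_lim _ (@cvg_einfs_sup _ X))//.
apply: ge_ereal_sup => _ [k _ <-]; apply: le_trans (XB k).
by apply: ereal_inf_lbound; exists k => /=.
Qed.

Lemma dotrN (R : realType) (N : nat) (x : 'rV[R]_N) : dotr (- x) (- x) = dotr x x.
Proof. by apply: eq_bigr => j _; rewrite !mxE mulrNN. Qed.

(** * Weighted integrals and the passage to [H1mu] *)

Section weighted_limits.
Context (R : realType) (N : nat).
Local Notation V := 'rV[R]_N.
Local Notation leb := (lebesgue_rV R N).
Variable mu : V -> R.
Hypotheses (mu_ge0 : forall x, 0 <= mu x) (mmu : measurable_fun setT mu).
Implicit Types (f g h phi u : V -> R) (Dphi : V -> V).

Lemma wint_ge0 f : (forall x, 0 <= f x) -> (0 <= wint mu f)%E.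
Proof. by move=> f0; apply: integral_ge0 => x _; rewrite lee_fin mulr_ge0. Qed.

Lemma wint_le_lin f g h (r q : R) :
  measurable_fun setT f -> measurable_fun setT g -> measurable_fun setT h ->
  (forall x, 0 <= f x) -> (forall x, 0 <= g x) -> (forall x, 0 <= h x) ->
  0 <= r -> 0 <= q -> (forall x, f x <= r * g x + q * h x) ->
  (wint mu f <= r%:E * wint mu g + q%:E * wint mu h)%E.
Proof.
move=> mf mg mh f0 g0 h0 r_ge0 q_ge0 fgh.
have mw (k : V -> R) : measurable_fun setT k ->
    measurable_fun setT (fun x => (k x * mu x)%:E).
  by move=> mk; apply/measurable_EFinP; exact: measurable_funM.
have w0 (k : V -> R) : (forall x, 0 <= k x) ->
    forall x : V, setT x -> (0 <= (k x * mu x)%:E)%E.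
  by move=> k0 x _; rewrite lee_fin mulr_ge0.
rewrite /wint -!ge0_integralZl//; [|exact: mw|exact: w0|exact: mw|exact: w0].
rewrite -ge0_integralD//.
- apply: ge0_le_integral => //; first exact: w0.
  + exact: mw.
  + by apply: emeasurable_funD; apply: measurable_funeM; exact: mw.
  + move=> x _; rewrite -!EFinM -EFinD lee_fin !mulrA -mulrDl.
    by rewrite ler_wpM2r.
- by move=> x _; rewrite mule_ge0// w0.
- by apply: measurable_funeM; exact: mw.
- by move=> x _; rewrite mule_ge0// w0.
- by apply: measurable_funeM; exact: mw.
Qed.

Lemma measurable_enorm2 Dphi : measurable_fun setT Dphi ->
  measurable_fun setT (fun x => enorm (Dphi x) ^+ 2).
Proof.
move=> /measurable_fun_rVP mD; under eq_fun do rewrite enorm2.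
by apply: measurable_sum => j; apply: measurable_funM.
Qed.

Lemma measurable_shift (b : V) : measurable_fun setT (fun x : V => x - b).
Proof.
apply/measurable_fun_rVP => j; under eq_fun do rewrite !mxE.
by apply: measurable_funD => //; exact: measurable_coord.
Qed.

Lemma measurable_test u : test_function u ->
  measurable_fun setT u /\ measurable_fun setT (grad u).
Proof.
move=> tu; split; first exact: (continuous_measurable_rV (tu.1 [::]).1).
apply/measurable_fun_rVP => j; under eq_fun do rewrite mxE.
by apply: continuous_measurable_rV; exact: (tu.1 [:: j]).1.
Qed.

(** The Young inequalities go from [phi] to an approximating [u k] on the left, and from [u k] back
    to [phi] and [Dphi] on the right, so only nonnegative integrals are added and none is
    subtracted. The bound [W] on [v] is what controls the error on the left by the [L^2_mu]
    distance. *)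
Lemma H1mu_closure (v : V -> R) (W c K : R) :
  measurable_fun setT v -> (forall x, 0 <= v x <= W) -> 0 <= c -> 0 <= K ->
  (forall u, test_function u ->
    (c%:E * wint mu (fun x => u x ^+ 2 * v x)%R <=
     wint mu (fun x => enorm (grad u x) ^+ 2)%R +
     K%:E * wint mu (fun x => u x ^+ 2)%R)%E) ->
  forall phi Dphi, H1mu mu phi Dphi ->
    (c%:E * wint mu (fun x => phi x ^+ 2 * v x)%R <=
     wint mu (fun x => enorm (Dphi x) ^+ 2)%R +
     K%:E * wint mu (fun x => phi x ^+ 2)%R)%E.
Proof.
move=> mv vW c0 K0 test phi Dphi [mphi mDphi fin [u tu u_phi]].
have sq0 f x : 0 <= f x ^+ 2 by exact: sqr_ge0.
have v0 x : 0 <= v x by have /andP[] := vW x.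
have W0 : 0 <= W by have /andP[/le_trans] := vW 0; apply.
set a1 := wint mu (fun x => enorm (Dphi x) ^+ 2).
set a2 := wint mu (fun x => phi x ^+ 2).
have a1_ge0 : (0 <= a1)%E by apply: wint_ge0 => x; exact: sqr_ge0.
have a2_ge0 : (0 <= a2)%E by apply: wint_ge0 => x; exact: sqr_ge0.
have [a1_fin a2_fin] : a1 \is a fin_num /\ a2 \is a fin_num.
  rewrite !ge0_fin_numE//; split; apply: le_lt_trans fin.
    by rewrite /H1mu_norm_sq -/a1 -/a2 leeDr.
  by rewrite /H1mu_norm_sq -/a1 -/a2 leeDl.
pose e1 k := wint mu (fun x => (u k x - phi x) ^+ 2).
pose e2 k := wint mu (fun x => enorm (grad (u k) x - Dphi x) ^+ 2).
have e1_ge0 k : (0 <= e1 k)%E by apply: wint_ge0 => x; exact: sqr_ge0.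
have e2_ge0 k : (0 <= e2 k)%E by apply: wint_ge0 => x; exact: sqr_ge0.
have small (del : R) : 0 < del ->
    exists k, (e1 k <= del%:E /\ e2 k <= del%:E)%E.
  move=> del0; move/fine_cvgP : u_phi => [nfin ncvg].
  have : \forall k \near \oo, fine (H1mu_norm_sq mu
      (fun x => u k x - phi x) (fun x => grad (u k) x - Dphi x)) < del.
    exact: (cvgr_lt 0 ncvg _ del0).
  move=> ncvg'; near \oo => k; exists k.
  pose nk k := H1mu_norm_sq mu (fun x => u k x - phi x)
    (fun x => grad (u k) x - Dphi x).
  have nk_fin : nk k \is a fin_num by near: k.
  have nk_del : (nk k <= del%:E)%E.
    by rewrite -[nk k]fineK// lee_fin; apply: ltW; near: k.
  split; apply: le_trans nk_del; rewrite /nk /H1mu_norm_sq -/(e1 k) -/(e2 k).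
    by rewrite leeDl.
  by rewrite leeDr.
have A1 := fineK a1_fin; have A2 := fineK a2_fin.
move: A1 A2; set r1 := fine a1; set r2 := fine a2 => A1 A2.
have r1_ge0 : 0 <= r1 by rewrite fine_ge0.
have r2_ge0 : 0 <= r2 by rewrite fine_ge0.
pose B := r1 + K * r2.
have B0 : 0 <= B by rewrite addr_ge0// mulr_ge0.
have -> : (a1 + K%:E * a2 = B%:E)%E by rewrite -A1 -A2 -EFinM -EFinD.
apply/lee_addgt0Pr => e e0; rewrite -EFinD.
(* Chosen so that the relative loss [(2 d + d^2) B <= 3 d B] is at most [e / 2]. *)
pose d := Num.min 1 (e / (6 * (B + 1))).
have B1 : 0 < B + 1 by rewrite ltr_wpDl.
have d0 : 0 < d by rewrite lt_min ltr01/= divr_gt0// mulr_gt0.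
have d1 : d <= 1 by rewrite ge_min lexx.
have dB : d * (6 * (B + 1)) <= e.
  by rewrite -ler_pdivlMr ?mulr_gt0// ge_min lexx orbT.
have dV0 : 0 < d^-1 by rewrite invr_gt0.
pose q := 1 + d^-1; have q0 : 0 <= q by rewrite addr_ge0// ltW.
(* [C] collects the coefficients of [del] in the final estimate; [del], chosen after [d], brings
   [C * del] below [e / 2]. *)
pose C := (1 + d) * q * (1 + K) + c * (q * W).
have C0 : 0 <= C by rewrite addr_ge0// ?mulr_ge0// addr_ge0// ltW.
have C1 : 0 < C + 1 by rewrite ltr_wpDl.
pose del := e / (2 * (C + 1)).
have del0 : 0 < del by rewrite divr_gt0// mulr_gt0.
have delC : del * (2 * (C + 1)) = e by rewrite /del divfK// gt_eqF// mulr_gt0.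
have [k [e1k e2k]] := small del del0.
have [mu_k mgu_k] := measurable_test (tu k).
have mdiff : measurable_fun setT (fun x => (u k x - phi x) ^+ 2).
  by apply: measurable_funX; exact: measurable_funB.
have mdgrad : measurable_fun setT (fun x => grad (u k) x - Dphi x).
  apply/measurable_fun_rVP => j; under eq_fun do rewrite !mxE -mulN1r.
  move/measurable_fun_rVP : mgu_k => /(_ j) mj.
  move/measurable_fun_rVP : mDphi => /(_ j) mDj.
  under eq_fun do rewrite mulN1r; apply: measurable_funB => //.
  by move: mj; under eq_fun do rewrite mxE.
have mphi2 : measurable_fun setT (fun x => phi x ^+ 2).
  exact: measurable_funX.
have muk2 : measurable_fun setT (fun x => u k x ^+ 2).
  exact: measurable_funX.
have d1_ge0 : 0 <= 1 + d by rewrite addr_ge0// ltW.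
have h1 : (wint mu (fun x => phi x ^+ 2 * v x)%R <=
    (1 + d)%:E * wint mu (fun x => u k x ^+ 2 * v x)%R + (q * W)%:E * e1 k)%E.
  apply: wint_le_lin => //.
  - exact: measurable_funM.
  - exact: measurable_funM.
  - by move=> x; rewrite mulr_ge0.
  - by move=> x; rewrite mulr_ge0.
  - by move=> x; exact: sqr_ge0.
  - by rewrite mulr_ge0.
  - move=> x; have := ler_wpM2r (v0 x) (sqr_young (phi x) (u k x) d0).
    move=> /le_trans; apply; rewrite mulrDl -/q.
    rewrite -[X in X + _]mulrA lerD2l [leRHS]mulrAC ler_wpM2l//.
      by rewrite mulr_ge0// sqr_ge0.
    by have /andP[] := vW x.
have h2 : (wint mu (fun x => enorm (grad (u k) x) ^+ 2)%R <=
    (1 + d)%:E * a1 + q%:E * e2 k)%E.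
  apply: wint_le_lin => //; try exact: measurable_enorm2;
    try by move=> x; exact: sqr_ge0.
  move=> x; have -> : enorm (grad (u k) x - Dphi x) ^+ 2 =
      enorm (Dphi x - grad (u k) x) ^+ 2 by rewrite !enorm2 -dotrN opprB.
  exact: enorm_young.
have h3 : (wint mu (fun x => u k x ^+ 2)%R <= (1 + d)%:E * a2 + q%:E * e1 k)%E.
  apply: wint_le_lin => //; try by move=> x; exact: sqr_ge0.
  by move=> x; rewrite -(sqrrN (u k x - phi x)) opprB; exact: sqr_young.
set X := wint mu (fun x => u k x ^+ 2 * v x) in h1.
have X0 : (0 <= X)%E by apply: wint_ge0 => x; rewrite mulr_ge0.
have cX : (c%:E * X <= ((1 + d) * B + q * (1 + K) * del)%:E)%E.
  apply: le_trans (test _ (tu k)) _.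
  have -> : (1 + d) * B + q * (1 + K) * del =
    ((1 + d) * r1 + q * del) + K * ((1 + d) * r2 + q * del) by rewrite /B; ring.
  rewrite EFinD (EFinM K); apply: leeD.
    apply: (le_trans h2); rewrite -A1 (EFinD (_ * _)) (EFinM _ r1) (EFinM q); apply: leeD => //.
    by rewrite lee_wpmul2l ?lee_fin.
  rewrite lee_wpmul2l ?lee_fin//.
  apply: (le_trans h3); rewrite -A2 (EFinD (_ * _)) (EFinM _ r2) (EFinM q); apply: leeD => //.
  by rewrite lee_wpmul2l ?lee_fin.
apply: (@le_trans _ _ (c%:E * ((1 + d)%:E * X + (q * W)%:E * e1 k))%E).
  by rewrite lee_wpmul2l ?lee_fin.
rewrite ge0_muleDr ?mule_ge0 ?lee_fin ?mulr_ge0// muleCA.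
apply: (@le_trans _ _ ((1 + d)%:E * ((1 + d) * B + q * (1 + K) * del)%:E
    + c%:E * ((q * W)%:E * del%:E))%E).
  apply: leeD; first by rewrite lee_wpmul2l ?lee_fin.
  by rewrite lee_wpmul2l ?lee_fin// lee_wpmul2l ?lee_fin// mulr_ge0.
rewrite -!EFinM -EFinD lee_fin.
have -> : (1 + d) * ((1 + d) * B + q * (1 + K) * del) + c * (q * W * del) =
   B + (2 * d + d * d) * B + C * del by rewrite /C; ring.
have dd : d * d * B <= d * B by rewrite ler_wpM2r// ler_piMl// ltW.
have : C * del <= e / 2.
  by rewrite -delC; have := del0; lra.
move: dB; rewrite mulrCA mulrDr mulr1; have := d0; lra.
Unshelve. all: by end_near. Qed.

End weighted_limits.

(** * Removal of the regularization *)

Section vanishing_regularization.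
Context (R : realType) (N n : nat).
Local Notation V := 'rV[R]_N.
Local Notation leb := (lebesgue_rV R N).
Variables (mu : V -> R) (a : 'I_n -> V) (phi : V -> R).
Hypotheses (mu_ge0 : forall x, 0 <= mu x) (mmu : measurable_fun setT mu).
Hypothesis mphi : measurable_fun setT phi.

Lemma measurable_reg_sq b eps :
  measurable_fun setT (reg_sq b eps : V -> R).
Proof.
have /measurable_fun_rVP mb := measurable_shift b.
apply: measurable_funD => //; apply: measurable_sum => j.
exact: measurable_funM.
Qed.

Lemma measurable_reg_sqV b eps : 0 < eps ->
  measurable_fun setT (fun x : V => (reg_sq b eps x)^-1).
Proof.
move=> e0; apply: measurable_funV_pos => [x|]; first exact/ltW/reg_sq_gt0.
exact: measurable_reg_sq.
Qed.

(* The factor [s / (eps + s)^2] is continuous, is at most [1 / (eps + s)], and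
   tends to [s^-1] also where [s = 0], since there [s^-1] is [0] in Rocq. *)
Lemma cvg_sqr_ratio (s : R) : 0 <= s ->
  s * ((k.+1%:R^-1 + s)^-1 ^+ 2) @[k --> \oo] --> s^-1.
Proof.
rewrite le_eqVlt => /predU1P[<-|s0].
  by under eq_fun do rewrite mul0r; rewrite invr0; exact: cvg_cst.
have -> : s^-1 = s * (((0 + s)^-1) * ((0 + s)^-1)).
  by rewrite add0r mulrA mulfV ?gt_eqF// mul1r.
under eq_fun do rewrite expr2.
have h : (k.+1%:R^-1 + s)^-1 @[k --> \oo] --> (0 + s)^-1.
  apply: cvgV; first by rewrite add0r gt_eqF.
  by apply: cvgD; [exact: cvg_harmonic|exact: cvg_cst].
by apply: cvgM; [exact: cvg_cst|exact: cvgM].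
Qed.

(** Fatou's lemma along [eps = 1 / (k + 1)], applied to the minorants [s / (eps + s)^2] of
    [1 / (eps + s)]. Unlike the latter they converge at the poles as well, to the default value
    [0^-1 = 0], so the limit holds at every point. *)
Lemma wint_singular_le (c : R) (B : \bar R) : 0 < c ->
  (forall eps, 0 < eps ->
    (c%:E * wint mu (fun x => phi x ^+ 2 * \sum_(i < n) (reg_sq (a i) eps x)^-1)%R
     <= B)%E) ->
  (c%:E * wint mu (fun x => \sum_(i < n) phi x ^+ 2 / enorm (x - a i) ^+ 2)%R
   <= B)%E.
Proof.
move=> c0 hB.
pose s i x := dotr (x - a i) (x - a i).
pose e (k : nat) : R := k.+1%:R^-1.
have e0 k : 0 < e k by rewrite invr_gt0.
pose F (k : nat) x := (phi x ^+ 2 *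
  \sum_(i < n) (s i x * ((reg_sq (a i) (e k) x)^-1 ^+ 2))) * mu x.
have s0 i x : 0 <= s i x by exact: dotr_ge0.
have F0 k x : 0 <= F k x.
  rewrite mulr_ge0// mulr_ge0 ?sqr_ge0// sumr_ge0// => i _.
  by rewrite mulr_ge0// sqr_ge0.
have ms i : measurable_fun setT (s i).
  have /measurable_fun_rVP mb := measurable_shift (a i).
  by apply: measurable_sum => j; exact: measurable_funM.
have mF k : measurable_fun setT (EFin \o F k).
  apply/measurable_EFinP; apply: measurable_funM => //.
  apply: measurable_funM; first exact: measurable_funX.
  apply: measurable_sum => i; apply: measurable_funM => //.
  by apply: measurable_funX; exact: measurable_reg_sqV.
have FB k : (\int[leb]_x (F k x)%:E <= (c^-1)%:E * B)%E.
  apply: (@le_trans _ _ (wint mu (fun x => phi x ^+ 2 *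
      \sum_(i < n) (reg_sq (a i) (e k) x)^-1))).
    apply: ge0_le_integral => //.
    - by move=> x _; rewrite lee_fin.
    - exact: mF.
    - apply/measurable_EFinP; apply: measurable_funM => //.
      apply: measurable_funM; first exact: measurable_funX.
      by apply: measurable_sum => i; exact: measurable_reg_sqV.
    - move=> x _; rewrite lee_fin ler_wpM2r// ler_wpM2l ?sqr_ge0//.
      apply: ler_sum => i _; have t0 := reg_sq_gt0 (a i) (e0 k) x.
      rewrite expr2 mulrA ler_piMl ?invr_ge0 ?(ltW t0)//.
      by rewrite ler_pdivrMr// mul1r /reg_sq lerDr ltW.
  rewrite -[X in (X <= _)%E]mul1e -(mulVf (lt0r_neq0 c0)) EFinM -muleA.
  by rewrite lee_wpmul2l ?lee_fin ?invr_ge0 ?(ltW c0)//; exact: hB.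
have cvgF x : (F k x)%:E @[k --> \oo] -->
    ((\sum_(i < n) phi x ^+ 2 / enorm (x - a i) ^+ 2) * mu x)%:E.
  apply: cvg_EFin; first by apply: nearW.
  rewrite -mulr_sumr; apply: cvgMl; apply: cvgMr.
  apply: cvg_big => [|i _]; first exact: add_continuous.
  by rewrite enorm2 -/(s i x); exact: cvg_sqr_ratio.
have fat : (wint mu (fun x => \sum_(i < n) phi x ^+ 2 / enorm (x - a i) ^+ 2)%R
    <= (c^-1)%:E * B)%E.
  have := @fatou _ _ _ leb _ measurableT (fun k => EFin \o F k) mF
    (fun k x _ => F0 k x).
  under eq_integral => x _ do rewrite (cvg_limn_einf_sup (cvgF x)).1.
  by move=> /le_trans; apply; apply: limn_einf_le => k; exact: FB.
apply: (@le_trans _ _ (c%:E * ((c^-1)%:E * B))%E).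
  by rewrite lee_wpmul2l ?lee_fin ?(ltW c0).
by rewrite muleA -EFinM mulfV ?gt_eqF// mul1e.
Qed.

End vanishing_regularization.

Theorem theorem3p1 (R : realType) (N n : nat) (N3 : (3 <= N)%N)
    (n2 : (2 <= n)%N)
    (a : 'I_n -> 'rV[R]_N) (a_inj : injective a)
    (r0 : R)
    (r0_min : is_minimum
      [set enorm (a p.1 - a p.2) / 2 | p in [set p : 'I_n * 'I_n | p.1 != p.2]]
      r0)
    (mu : 'rV[R]_N -> R) (mu_ge0 : forall x, 0 <= mu x)
    (Dmu : 'rV[R]_N -> 'rV[R]_N) (H1 : hyp_H1 mu Dmu)
    (k1 k2 : R) (k2_gt : 2 - N%:R < k2) (H2 : hyp_H2 a r0 mu Dmu k1 k2) :
  exists k0 : R, [/\ 0 <= k0, k0 < pi ^+ 2 &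
    forall c : R, 0 < c -> c <= c_o (N%:R + k2) ->
    forall (phi : 'rV[R]_N -> R) (Dphi : 'rV[R]_N -> 'rV[R]_N),
      H1mu mu phi Dphi ->
      (c%:E * wint mu (fun x =>
                 \sum_(i < n) phi x ^+ 2 / enorm (x - a i) ^+ 2)%R
       <= wint mu (fun x => enorm (Dphi x) ^+ 2)%R
          + ((k0 + n.+1%:R * c) / r0 ^+ 2 + k1)%:E
            * wint mu (fun x => phi x ^+ 2)%R)%E].
Proof.
have [lmu _ linv] := H1.
(* The minimum is attained at a pair of distinct indices: this makes [r0] positive, and [p.1]
   supplies the pole at which [k1_ge0] is applied. *)
have [[p /= p12 r0E] r0_lb] := r0_min.
have enorm_gt0 (x : 'rV[R]_N) : x != 0 -> 0 < enorm x.
  move=> x0; rewrite sqrtr_gt0 lt_neqAle dotr_ge0 andbT eq_sym.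
  apply: contra x0; rewrite psumr_eq0 => [|j _]; last by rewrite -expr2 sqr_ge0.
  move=> /allP h; apply/eqP/rowP => j; rewrite mxE.
  by have := h j (mem_index_enum j); rewrite -expr2 sqrf_eq0 => /eqP.
have r0_gt0 : 0 < r0.
  rewrite -r0E divr_gt0// enorm_gt0// subr_eq0.
  by apply: contra p12 => /eqP/a_inj ->.
have a_sep i j : i != j -> 4 * r0 ^+ 2 <= dotr (a i - a j) (a i - a j).
  move=> ij; rewrite -enorm2.
  have : r0 <= enorm (a i - a j) / 2 by apply: r0_lb; exists (i, j).
  rewrite ler_pdivlMr// => r0_le.
  have -> : 4 * r0 ^+ 2 = (r0 * 2) ^+ 2 by ring.
  by rewrite lerXn2r ?nnegrE ?sqrtr_ge0// mulr_ge0// ltW.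
have mmu : measurable_fun setT mu.
  apply/measurable_EFinP; apply: L1loc_measurable; by have [] := lmu.
have k1_0 : 0 <= k1 := k1_ge0 mu_ge0 H2 p.1 r0_gt0 linv.
exists 1; split=> //.
  by rewrite -(expr1n R 2) ltrXn2r ?nnegrE ?pi_ge0// (lt_le_trans _ (pi_ge2 R))// ltr1n.
move=> c c0 c_le phi Dphi Hphi.
pose m := N%:R + k2 - 2.
have m0 : 0 < m by rewrite /m; lra.
have cm : c <= (m / 2) ^+ 2 by [].
(* [b = m / 2 - q] is the smaller root of [b (m - b) = c], real since [c <= (m / 2)^2]. Being at
   most [m / 2] it satisfies [b^2 <= c], whence [2 b <= 1 + b^2 <= 1 + c]. *)
pose q := Num.sqrt ((m / 2) ^+ 2 - c).
have q2 : q ^+ 2 = (m / 2) ^+ 2 - c by rewrite sqr_sqrtr// subr_ge0.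
have q0 : 0 <= q by rewrite sqrtr_ge0.
have qm : q <= m / 2.
  have m20 : 0 <= m / 2 by rewrite divr_ge0// ltW.
  by rewrite -[leRHS](ger0_norm m20) -sqrtr_sqr ler_wsqrtr// gerBl ltW.
pose b := m / 2 - q.
have bE : b * (m - b) = c.
  transitivity ((m / 2) ^+ 2 - q ^+ 2); first by rewrite /b; field.
  by rewrite q2 subKr.
have b0 : 0 <= b by rewrite subr_ge0.
have bc : 2 * b <= 1 + b * (m - b).
  have : b * b <= b * (m - b) by rewrite ler_wpM2l// /b; lra.
  by have := sqr_ge0 (b - 1); lra.
have K0 : 0 <= (1 + n.+1%:R * c) / r0 ^+ 2.
  by rewrite divr_ge0 ?sqr_ge0// addr_ge0// mulr_ge0// ltW.
apply: (@le_trans _ _ (wint mu (fun x => enorm (Dphi x) ^+ 2)%R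
    + ((1 + n.+1%:R * c) / r0 ^+ 2)%:E * wint mu (fun x => phi x ^+ 2)%R)%E).
  apply: wint_singular_le => //; first by case: Hphi.
  move=> eps eps0.
  (* For fixed [eps] each of the [n] inverses is at most [1 / eps], which gives the bound [n / eps]
     on the weight. *)
  apply: (@H1mu_closure _ _ _ mu_ge0 mmu _ (n%:R / eps)) (Hphi) => //.
  - by apply: measurable_sum => i; exact: measurable_reg_sqV.
  - move=> x; apply/andP; split.
      by apply: sumr_ge0 => i _; rewrite invr_ge0 ltW// reg_sq_gt0.
    rewrite mulr_natl -[X in _ *+ X]card_ord -sumr_const; apply: ler_sum => i _.
    by rewrite lef_pV2 ?posrE ?reg_sq_gt0// lerDl dotr_ge0.
  - exact: ltW.
  - move=> u tu; rewrite -bE.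
    have := @hardy_test R N n a r0 mu Dmu k2 b r0_gt0 mu_ge0 a_sep lmu
      (radial_derivative_ge H2) (ltW m0) b0 _ bc u eps tu eps0.
    rewrite bE => /(_ (ltW c0)).
    by under eq_fun do rewrite -mulr_sumr.
(* The inequality just proved has no [k1]; since [k1 >= 0], adding it only enlarges the right
   side. *)
rewrite leeD2l// lee_wpmul2r//; first by apply: wint_ge0 => // x; exact: sqr_ge0.
by rewrite lee_fin lerDl.
Qed.
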